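(* Let $m,n,s,k$ be four integers such that $3\leq s\leq n$, $3\leq k\leq m$ and $ms=nk$. There exists a signed magic array $\mathrm{SMA}(m,n;s,k)$ whenever $\gcd(s,k)\geq 2$.
   Context: A partially filled (pf) array is a matrix some of whose cells may be empty; row and column sums are taken over the filled cells. A signed magic array $\mathrm{SMA}(m,n;s,k)$ is an $m\times n$ pf array with entries in $\Omega\subset\mathbb{Z}$, where $\Omega=\{0,\pm1,\pm2,\ldots,\pm(nk-1)/2\}$ if $nk$ is odd and $\Omega=\{\pm1,\pm2,\ldots,\pm nk/2\}$ if $nk$ is even, such that: (a) each row contains exactly $s$ filled cells and each column contains exactly $k$ filled cells; (b) every $x\in\Omega$ appears exactly once in the array; (c) the elements in every row and in every column sum to $0$. *)

(* Defs.v *)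
From mathcomp Require Import all_boot all_order all_algebra.

Set Implicit Arguments.
Unset Strict Implicit.
Unset Printing Implicit Defensive.

Import GRing.Theory Num.Theory.
Local Open Scope ring_scope.

(* An m x n partially filled array; None is an empty cell. *)
Definition pf_array (m n : nat) := 'M[option int]_(m, n).

Section PFArray.
Variables (m n : nat) (A : pf_array m n).

Definition row_filled (i : 'I_m) : {set 'I_n} := [set j | isSome (A i j)].
Definition col_filled (j : 'I_n) : {set 'I_m} := [set i | isSome (A i j)].

(* The default value 0 of odflt is never used: only filled cells are summed. *)
Definition row_sum (i : 'I_m) : int :=
  \sum_(j in row_filled i) odflt 0 (A i j).
Definition col_sum (j : 'I_n) : int :=
  \sum_(i in col_filled j) odflt 0 (A i j).

Definition occurrences (x : int) : {set 'I_m * 'I_n} :=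
  [set c | A c.1 c.2 == Some x].

End PFArray.

(* Omega, as a function of the number N = n * k of filled cells. *)
Definition sma_support (N : nat) : pred int :=
  fun x => if odd N then (`|x| <= (N - 1) %/ 2)%N
           else (x != 0) && (`|x| <= N %/ 2)%N.

Record is_SMA (m n s k : nat) (A : pf_array m n) : Prop := IsSMA {
  sma_entries : forall i j x, A i j = Some x -> sma_support (n * k) x;
  sma_row_filled : forall i, #|row_filled A i| = s;
  sma_col_filled : forall j, #|col_filled A j| = k;
  sma_once : forall x, sma_support (n * k) x -> #|occurrences A x| = 1%N;
  sma_row_sum : forall i, row_sum A i = 0;
  sma_col_sum : forall j, col_sum A j = 0
}.

(* Main.v *)
Require Import Defs.
From mathcomp Require Import all_boot all_order all_algebra.
From mathcomp Require Import zify.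

(* Let d = gcd(m, n), c = gcd(s, k) and L = lcm(m, n); then c <= d. For t < c
   take an offset o_t, with distinct residues mod d. By the Chinese remainder
   theorem the cells (j, t), for j in Z_L and t < c, placed in row j + o_t mod m
   and column j mod n, are pairwise distinct, with s cells in each row and k in
   each column.

   If c is odd, take o_t = t: it is then enough to fill c consecutive cyclic
   diagonals of an L x L square so that its rows and columns sum to 0. Four more
   diagonals a_j, -a_(j+1), b_j, -b_(j+1) with a_j + b_j constant can always be
   added, so only c = 3 and c = 5 remain. There the general solution of the row
   and column equations is a combination of shifts of one, respectively three,
   periodic sequences, and these can be chosen explicitly.

   If c is even, the diagonals are paired at distance e, with entries that are
   opposite in each column; the rows then sum to 0 as soon as the row sums of one
   diagonal from each pair are invariant under a cyclic shift of the rows by e.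
   This fails only when m and n are 2 mod 4 and the array is full, and then a 6 x 6
   array is completed by 2 x 4 and 4 x 2 blocks with zero row and column sums. *)

Set Implicit Arguments.
Unset Strict Implicit.
Unset Printing Implicit Defensive.

Import GRing.Theory Num.Theory.
Local Open Scope ring_scope.

(** * Arrays from lists of cells *)

(** Numbers the elements of Omega from 0 to N - 1. For even N, 0 is missing from Omega, hence the
    positive elements move down by one. *)
Definition sma_code (N : nat) (x : int) : nat :=
  if ~~ odd N && (0 < x) then `|(x + (N./2)%:Z - 1)%R|%N else `|(x + (N./2)%:Z)%R|%N.

Lemma sma_code_lt N x : sma_support N x -> (sma_code N x < N)%N.
Proof.
rewrite /sma_support /sma_code divn2; case: ifP => /= oN; first by lia.
by case: ifP; lia.
Qed.

Lemma sma_code_inj N x y : sma_support N x -> sma_support N y ->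
  sma_code N x = sma_code N y -> x = y.
Proof.
rewrite /sma_support /sma_code !divn2; case: ifP => /= oN; first by lia.
by case: ifP; case: ifP; lia.
Qed.

(** Pigeonhole through [sma_code]: Omega has at most N elements, so N distinct entries in it exhaust
    it. *)
Lemma sma_support_surj (C : finType) N (val : C -> int) :
    #|C| = N -> injective val -> (forall c, sma_support N (val c)) ->
  forall x, sma_support N x -> exists c, val c = x.
Proof.
move=> cardC val_inj val_sup x x_sup.
have lt_code c : (sma_code N (val c) < N)%N by exact: sma_code_lt.
pose f c := Ordinal (lt_code c).
have f_inj : injective f.
  by move=> c1 c2 [] /sma_code_inj eq12; apply/val_inj/eq12.
have leNC : (#|'I_N| <= #|C|)%N by rewrite card_ord cardC.
have /codomP[c [eqc]] := inj_card_onto f_inj leNC (Ordinal (sma_code_lt x_sup)).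
by exists c; apply: sma_code_inj (esym eqc).
Qed.

Lemma big_pick (R : Type) (idx : R) (op : Monoid.com_law idx)
    (C : finType) (P : pred C) (F : C -> R) :
    {in P &, forall c1 c2, c1 = c2} ->
  oapp F idx [pick c | P c] = \big[op/idx]_(c | P c) F c.
Proof.
move=> uniqP; case: pickP => [c Pc | P0] /=; last by rewrite big_pred0.
by rewrite (big_pred1 c) // => b; apply/idP/eqP => [Pb | ->//]; apply: uniqP.
Qed.

Section FromCells.

Variables (C : finType) (m n s k : nat).
Variables (row : C -> 'I_m) (col : C -> 'I_n) (val : C -> int).
Hypothesis cell_inj : injective (fun c => (row c, col c)).

Definition cell_array : pf_array m n :=
  \matrix_(i, j) omap val [pick c | (row c == i) && (col c == j)].

Lemma cell_at_uniq i j :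
  {in [pred c | (row c == i) && (col c == j)] &, forall c1 c2, c1 = c2}.
Proof.
move=> c1 c2 /andP[/eqP r1 /eqP k1] /andP[/eqP r2 /eqP k2].
by apply: cell_inj; rewrite r1 k1 r2 k2.
Qed.

Lemma cell_arrayP i j x :
  cell_array i j = Some x <-> exists c, [/\ row c = i, col c = j & val c = x].
Proof.
rewrite mxE; case: pickP => [c /andP[/eqP rc /eqP kc] | no_c] /=; split.
- by case=> <-; exists c.
- move=> [b [rb kb <-]]; congr (Some (val _)); apply: cell_inj.
  by rewrite rc kc rb kb.
- by [].
- by move=> [b [rb kb _]]; have := no_c b; rewrite rb kb !eqxx.
Qed.

(** The monoid is arbitrary so that one identity both counts filled cells in [nat] and sums entries
    in [int]; empty cells contribute the unit. *)
Lemma big_row_cells (R : Type) (idx : R) (op : Monoid.com_law idx) (F : C -> R) i :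
  \big[op/idx]_j oapp F idx [pick c | (row c == i) && (col c == j)] =
    \big[op/idx]_(c | row c == i) F c.
Proof.
rewrite [RHS](partition_big col xpredT) //=; apply: eq_bigr => j _.
by rewrite (big_pick op) //; apply: cell_at_uniq.
Qed.

Lemma big_col_cells (R : Type) (idx : R) (op : Monoid.com_law idx) (F : C -> R) j :
  \big[op/idx]_i oapp F idx [pick c | (row c == i) && (col c == j)] =
    \big[op/idx]_(c | col c == j) F c.
Proof.
rewrite [RHS](partition_big row xpredT) //=; apply: eq_bigr => i _.
rewrite (big_pick op); last exact: cell_at_uniq.
by apply: eq_bigl => c; rewrite andbC.
Qed.

Lemma is_SMA_cells :
    #|C| = (n * k)%N -> injective val ->
    (forall c, sma_support (n * k) (val c)) ->
    (forall i, #|[set c | row c == i]| = s) ->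
    (forall j, #|[set c | col c == j]| = k) ->
    (forall i, \sum_(c | row c == i) val c = 0) ->
    (forall j, \sum_(c | col c == j) val c = 0) ->
  is_SMA s k cell_array.
Proof.
move=> cardC val_inj val_sup card_row card_col sum_row sum_col.
have valE i j : odflt 0 (cell_array i j) =
    oapp val 0 [pick c | (row c == i) && (col c == j)].
  by rewrite mxE; case: pickP.
split.
- by move=> i j x /cell_arrayP[c [_ _ <-]].
- move=> i;
  rewrite -(card_row i) -sum1dep_card -sum1dep_card -(big_row_cells _ (fun=> 1%N)).
  rewrite [LHS]big_mkcond.
  apply: eq_bigr => j _.
  by rewrite mxE; case: pickP.
- move=> j;
  rewrite -(card_col j) -sum1dep_card -sum1dep_card -(big_col_cells _ (fun=> 1%N)).
  rewrite [LHS]big_mkcond.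
  apply: eq_bigr => i _.
  by rewrite mxE; case: pickP.
- move=> x /(sma_support_surj cardC val_inj val_sup)[c <-].
  rewrite (_ : occurrences _ _ = [set (row c, col c)]) ?cards1 //.
  apply/setP=> -[i j]; rewrite !inE /=; apply/eqP/eqP => [/cell_arrayP | [-> ->]].
    by move=> [b [<- <- /val_inj->]].
  by apply/cell_arrayP; exists c.
- move=> i; rewrite /row_sum -[RHS](sum_row i) -big_row_cells [LHS]big_mkcond.
  apply: eq_bigr => j _.
  by rewrite inE -valE; case: (cell_array i j).
- move=> j; rewrite /col_sum -[RHS](sum_col j) -big_col_cells [LHS]big_mkcond.
  apply: eq_bigr => i _.
  by rewrite inE -valE; case: (cell_array i j).
Qed.

End FromCells.

(** * Cyclic patterns *)

Section PeriodicSums.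

Variables (R : Type) (idx : R) (op : Monoid.com_law idx).
Implicit Type F : nat -> R.

Lemma big_ord_shift F (L o : nat) : (forall j, F (j + L)%N = F j) ->
  \big[op/idx]_(j < L) F (j + o)%N = \big[op/idx]_(j < L) F j.
Proof.
move=> perF; elim: o => [|o IHo]; first by apply: eq_bigr => j _; rewrite addn0.
rewrite -{}IHo; case: L perF => [|L] perF; first by rewrite !big_ord0.
rewrite [LHS]big_ord_recr [RHS]big_ord_recl [RHS]Monoid.mulmC /=; congr (op _ _);
  last first.
  by rewrite -(perF (0 + o)%N); congr F; lia.
by apply: eq_bigr => j _; rewrite /= /bump; congr F; lia.
Qed.

Lemma big_ord_modn F (x m r : nat) : (r < m)%N ->
  \big[op/idx]_(j < x * m | (j %% m == r)%N) F j =
    \big[op/idx]_(l < x) F (l * m + r)%N.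
Proof.
move=> lt_rm; elim: x => [|x IHx]; first by rewrite mul0n !big_ord0.
rewrite big_ord_recr /= -{}IHx -(big_mkord (fun j => j %% m == r)%N F).
rewrite -(big_mkord (fun j => j %% m == r)%N F).
rewrite (big_cat_nat (leq0n (x * m))) ?leq_mul //=; congr (op _ _).
rewrite -{1}[(x * m)%N]add0n big_addn mulSn addnK big_nat_cond.
rewrite (eq_bigl (fun j => (0 <= j < m) && (j == r)))%N => [|j]; last first.
  rewrite addnC modnMDl; case: ltnP => //= lt_jm.
  by rewrite modn_small.
by rewrite -big_nat_cond big_nat1_eq /= lt_rm addnC.
Qed.

Lemma big_ord_modn_shift F (x m o r : nat) :
    (r < m)%N -> (forall j, F (j + x * m)%N = F j) ->
  \big[op/idx]_(j < x * m | ((j + o) %% m == r)%N) F (j + o)%N =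
    \big[op/idx]_(l < x) F (l * m + r)%N.
Proof.
move=> lt_rm perF; rewrite -big_ord_modn // big_mkcond [RHS]big_mkcond /=.
pose G j := if (j %% m == r)%N then F j else idx.
apply: (big_ord_shift _ (F := G)) => j.
by rewrite /G perF addnC modnMDl.
Qed.

Lemma big_ord_double F (x : nat) :
  \big[op/idx]_(t < x.*2) F t = \big[op/idx]_(t < x) op (F t.*2) (F t.*2.+1).
Proof.
by elim: x => [|x IHx]; rewrite ?big_ord0 // doubleS !big_ord_recr IHx Monoid.mulmA.
Qed.

Lemma big_ord_mul F (x y : nat) :
  \big[op/idx]_(w < x * y) F w =
    \big[op/idx]_(l < x) \big[op/idx]_(t < y) F (l * y + t)%N.
Proof.
elim: x => [|x IHx]; first by rewrite mul0n !big_ord0.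
by rewrite mulSnr big_split_ord big_ord_recr IHx.
Qed.

End PeriodicSums.

Section CyclicPattern.

Variables (m n c : nat) (off : nat -> nat) (Y : nat -> nat -> int).
Hypotheses (m_gt0 : (0 < m)%N) (n_gt0 : (0 < n)%N).

Let L := lcmn m n.

Hypothesis off_inj : forall t1 t2, (t1 < c)%N -> (t2 < c)%N ->
  off t1 = off t2 %[mod gcdn m n] -> t1 = t2.

Let cells : finType := ('I_L * 'I_c)%type.
Let row (p : cells) : 'I_m := Ordinal (ltn_pmod (p.1 + off p.2) m_gt0).
Let col (p : cells) : 'I_n := Ordinal (ltn_pmod p.1 n_gt0).

(** Row minus column is [off t] modulo gcd(m, n), which determines t. Then j is known modulo m and
    modulo n, hence modulo L. *)
Lemma cyclic_cell_inj : injective (fun p => (row p, col p)).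
Proof.
case=> [j1 t1] [j2 t2] [eq_row eq_col].
have /eqP eq_t : off t1 == off t2 %[mod gcdn m n].
  rewrite -(eqn_modDl j1) -(modn_dvdm _ (dvdn_gcdl m n)) eq_row.
  rewrite modn_dvdm ?dvdn_gcdl // eqn_modDr.
  by rewrite -(modn_dvdm _ (dvdn_gcdr m n)) -eq_col modn_dvdm ?dvdn_gcdr.
have {eq_t} eq_t : t1 = t2 by apply/val_inj; apply: off_inj eq_t.
move: eq_row; rewrite -{}eq_t => /eqP; rewrite eqn_modDr => /eqP eq_row.
congr (_, _); apply/val_inj => /=.
rewrite -(modn_small (ltn_ord j1)) -(modn_small (ltn_ord j2)).
wlog le12 : j1 j2 eq_row eq_col / (j1 <= j2)%N.
  by move=> IH; case/orP: (leq_total j1 j2) => ?; [|symmetry]; apply: IH.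
apply/eqP; rewrite eq_sym eqn_mod_dvd // dvdn_lcm -!eqn_mod_dvd //.
by rewrite eq_row eq_col !eqxx.
Qed.

Lemma exists_SMA_cyclic (s k : nat) :
    (m * s = c * L)%N -> (n * k = c * L)%N ->
    (forall j t, (j < L)%N -> (t < c)%N -> sma_support (c * L) (Y j t)) ->
    (forall j1 t1 j2 t2, (j1 < L)%N -> (t1 < c)%N -> (j2 < L)%N -> (t2 < c)%N ->
       Y j1 t1 = Y j2 t2 -> j1 = j2 /\ t1 = t2) ->
    (forall j, (j < L)%N -> \sum_(t < c) Y j t = 0) ->
    (forall r, (r < m)%N ->
       \sum_(t < c) \sum_(j < L | ((j + off t) %% m == r)%N) Y j t = 0) ->
  exists A : pf_array m n, is_SMA s k A.
Proof.
move=> ms nk supY injY colY rowY.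
have [x Lx] : exists x, L = (x * m)%N by exact/dvdnP/dvdn_lcml.
have [y Ly] : exists y, L = (y * n)%N by exact/dvdnP/dvdn_lcmr.
have big_row (R : Type) (idx : R) (op : Monoid.com_law idx) (F : nat -> nat -> R) i :
    \big[op/idx]_(p : cells | row p == i) F p.1 p.2 =
    \big[op/idx]_(t < c) \big[op/idx]_(j < L | ((j + off t) %% m == i)%N) F j t.
  rewrite (exchange_big_dep xpredT) //= pair_big_dep /=.
  by apply: eq_bigl => -[j t].
have big_col (R : Type) (idx : R) (op : Monoid.com_law idx) (F : nat -> nat -> R) i :
    \big[op/idx]_(p : cells | col p == i) F p.1 p.2 =
    \big[op/idx]_(j < L | (j %% n == i)%N) \big[op/idx]_(t < c) F j t.
  rewrite pair_big_dep /=.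
  by apply: eq_bigl => -[j t]; rewrite andbT.
exists (cell_array row col (fun p => Y p.1 p.2)).
apply: is_SMA_cells.
- exact: cyclic_cell_inj.
- by rewrite card_prod !card_ord nk mulnC.
- case=> [j1 t1] [j2 t2] /= /injY[]// /val_inj -> /val_inj -> //.
- by move=> [j t]; rewrite nk; apply: supY.
- move=> i; rewrite -sum1dep_card (big_row _ _ _ (fun _ _ => 1%N)).
  under eq_bigr => t _.
    rewrite Lx (@big_ord_modn_shift _ _ _ (fun=> 1%N)) // sum1_card card_ord; over.
  rewrite sum_nat_const card_ord; apply/eqP.
  by rewrite -(eqn_pmul2l m_gt0) ms Lx mulnCA [(m * _)%N]mulnC.
- move=> i; rewrite -sum1dep_card (big_col _ _ _ (fun _ _ => 1%N)).
  rewrite Ly (big_ord_modn _ (fun=> _)) // sum_nat_const card_ord sum1_card card_ord.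
  by apply/eqP; rewrite -(eqn_pmul2l n_gt0) nk Ly mulnA mulnC [(n * _)%N]mulnC.
- by move=> i; rewrite (big_row _ _ _ Y) rowY.
- by move=> i; rewrite (big_col _ _ _ Y) big1 // => j _; rewrite colY.
Qed.

End CyclicPattern.

(** * Opposite pairs of diagonals *)

Section OppositePairs.

(* Row r of B lists the entries that row r receives from the first diagonals of
   the pairs; these diagonals have offsets o t, their partners o t + e. *)
Variables (m n c e s k : nat) (o : nat -> nat) (B : nat -> nat -> int).
Hypotheses (m_gt0 : (0 < m)%N) (n_gt0 : (0 < n)%N).

Let L := lcmn m n.
Let W := (L %/ m * c)%N.
Let off t := (o t./2 + odd t * e)%N.
(** Here [i] is a row of the L x L square, folded onto m rows: i mod m is the row of [B], and i / m
    selects a block of [c] entries in it. *)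
Let b i t := B (i %% m) (i %/ m * c + t).
Let Y j t := if odd t then - b ((j + o t./2) %% L) t./2
             else b ((j + o t./2) %% L) t./2.

(** Partners cancel in each column. Row r receives the entries of row r of [B] and the opposites of
    those of row r - e, whence the invariance hypothesis. The absolute values fill 1, ..., m * W, so
    both signs together fill Omega. *)
Lemma exists_SMA_opposite_pairs :
    (m * s = c.*2 * L)%N -> (n * k = c.*2 * L)%N ->
    (forall t1 t2, (t1 < c.*2)%N -> (t2 < c.*2)%N ->
       off t1 = off t2 %[mod gcdn m n] -> t1 = t2) ->
    (forall r w, (r < m)%N -> (w < W)%N -> (0 < `|B r w| <= m * W)%N) ->
    (forall r1 w1 r2 w2, (r1 < m)%N -> (w1 < W)%N -> (r2 < m)%N -> (w2 < W)%N ->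
       `|B r1 w1|%N = `|B r2 w2|%N -> r1 = r2 /\ w1 = w2) ->
    (forall r, (r < m)%N ->
       \sum_(w < W) B ((r + e) %% m)%N w = \sum_(w < W) B r w) ->
  exists A : pf_array m n, is_SMA s k A.
Proof.
move=> ms nk off_inj B_bound B_inj B_sum.
have L_gt0 : (0 < L)%N by rewrite lcmn_gt0 m_gt0.
have Lx : L = (L %/ m * m)%N by rewrite divnK ?dvdn_lcml.
have mW : (m * W = c * L)%N by rewrite /W mulnA [(m * _)%N]mulnC -Lx mulnC.
have ltW i t : (i < L)%N -> (t < c)%N -> (i %/ m * c + t < W)%N.
  move=> lt_iL lt_tc; have : (i %/ m < L %/ m)%N by rewrite ltn_divLR // -Lx.
  by rewrite /W -(leq_pmul2r (leq_trans (ltn0Sn t) lt_tc)) mulSn; lia.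
have absY j t : `|Y j t|%N = `|b ((j + o t./2) %% L) t./2|%N.
  by rewrite /Y; case: odd; rewrite ?abszN.
apply: (exists_SMA_cyclic (c := c.*2) (off := off) (Y := Y)) => //.
- move=> j t lt_jL lt_tc; have lt_tc2 : (t./2 < c)%N by lia.
  have lt_iL := ltn_pmod (j + o t./2) L_gt0.
  rewrite /sma_support -!doubleMl odd_double divn2 doubleK -mW absY -absz_gt0 absY.
  by apply: B_bound; rewrite ?ltn_pmod ?ltW.
- move=> j1 t1 j2 t2 lt_jL1 lt_tc1 lt_jL2 lt_tc2 eqY.
  have lt_iL1 := ltn_pmod (j1 + o t1./2) L_gt0.
  have lt_iL2 := ltn_pmod (j2 + o t2./2) L_gt0.
  have lt_t1 : (t1./2 < c)%N by lia.
  have lt_t2 : (t2./2 < c)%N by lia.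
  have := absY j1 t1; rewrite eqY absY /b => /esym/B_inj[];
    rewrite ?ltn_pmod ?ltW // => eq_m eq_w.
  have eq_t : t1./2 = t2./2.
    by move/(congr1 (modn^~ c)): eq_w; rewrite !modnMDl !modn_small.
  have eq_i : ((j1 + o t1./2) %% L = (j2 + o t2./2) %% L)%N.
    move: eq_w; rewrite eq_t => /addIn/eqP;
      rewrite eqn_pmul2r ?(leq_ltn_trans _ lt_t1) // => /eqP eq_d.
    by rewrite [LHS](divn_eq _ m) [RHS](divn_eq _ m) eq_d -eq_m eq_t.
  have eq_odd : odd t1 = odd t2.
    move: eqY; rewrite /Y eq_i eq_t.
    have := B_bound _ _ (ltn_pmod ((j2 + o t2./2) %% L) m_gt0) (ltW _ _ lt_iL2 lt_t2).
    rewrite -/(b _ _); move: (b _ _) => x; clear.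
    by case: (odd t1); case: (odd t2) => //; lia.
  have eq_t12 : t1 = t2 by rewrite -[t1]odd_double_half -[t2]odd_double_half eq_t eq_odd.
  split=> //; move/eqP: eq_i; rewrite eq_t eqn_modDr => /eqP.
  by rewrite !modn_small.
- move=> j _; rewrite big_ord_double big1 // => t _.
  by rewrite /Y /= odd_double uphalf_double doubleK subrr.
move=> r lt_rm.
have sum_b r1 : (r1 < m)%N ->
    \sum_(t < c) \sum_(j < L | ((j + o t) %% m == r1)%N) b ((j + o t) %% L) t =
    \sum_(w < W) B r1 w.
  move=> lt_r1m; rewrite /W big_ord_mul [RHS]exchange_big; apply: eq_bigr => t _.
  rewrite Lx mulnK // (big_ord_modn_shift _ (F := fun i => b (i %% (L %/ m * m)) t)) //; last first.
    by move=> j; rewrite modnDr.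
  apply: eq_bigr => l _; rewrite modn_small; last first.
    by rewrite (leq_trans (n := (l * m + m)%N)) ?ltn_add2l // -mulSnr leq_mul2r ltn_ord orbT.
  by rewrite /b modnMDl modn_small // divnMDl // (divn_small lt_r1m) addn0.
(* This is r - e modulo m, the row whose entries arrive negated in row r. *)
pose r1 := ((r + (m - e %% m)) %% m)%N.
have lt_r1m : (r1 < m)%N by exact: ltn_pmod.
have r1K : ((r1 + e) %% m = r)%N.
  rewrite /r1 modnDml -modnDmr -addnA subnK; last by rewrite ltnW ?ltn_pmod.
  by rewrite modnDr modn_small.
rewrite (big_ord_double _ (fun t => \sum_(j < L | ((j + off t) %% m == r)%N) Y j t)).
transitivity (\sum_(w < W) B r w - \sum_(w < W) B r1 w); last first.
  by rewrite -{1}r1K B_sum // subrr.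
rewrite -(sum_b r) // -(sum_b r1) // -sumrB; apply: eq_bigr => t _.
rewrite /off /Y /= odd_double uphalf_double doubleK addn0; congr (_ + _).
rewrite -sumrN mul1n; apply: eq_bigl => j; rewrite addnA.
apply/eqP/eqP => [eq_r|eq_r1]; last by rewrite -modnDml eq_r1 r1K.
apply/eqP; rewrite -[X in _ == X](modn_small lt_r1m) -(eqn_modDr e); apply/eqP.
by rewrite eq_r r1K.
Qed.

End OppositePairs.

Lemma euclid_inj (d q1 r1 q2 r2 : nat) : (r1 < d)%N -> (r2 < d)%N ->
  (q1 * d + r1 = q2 * d + r2)%N -> q1 = q2 /\ r1 = r2.
Proof.
move=> lt1 lt2 eq12; have d_gt0 := leq_ltn_trans (leq0n _) lt1.
move: (congr1 (divn^~ d) eq12) (congr1 (modn^~ d) eq12).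
by rewrite !divnMDl // !divn_small // !addn0 !modnMDl !modn_small.
Qed.

(** Consecutive terms pair to -1, whatever the starting point [a]: this makes the padding contribute
    equally to all rows. *)
Lemma sum_alternating (a x : nat) : ~~ odd x ->
  \sum_(w < x) (-1) ^+ w * (a + w)%:Z = - (x./2)%:Z.
Proof.
move=> /even_halfK <-; rewrite doubleK; elim: x./2 => [|y IHy];
  first by rewrite big_ord0.
by rewrite doubleS !big_ord_recr IHy /= exprS -mul2n exprM sqrrN !expr1n; lia.
Qed.

Section PadRows.

(* Only the first p entries of each row matter: the others are completed by
   consecutive integers with alternating signs, which add the same amount to
   every row. *)
Variables (m n c e s k p : nat) (o : nat -> nat) (Q : nat -> nat -> nat).
Hypotheses (m_gt0 : (0 < m)%N) (n_gt0 : (0 < n)%N).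

Let L := lcmn m n.
Let W := (L %/ m * c)%N.
Let off t := (o t./2 + odd t * e)%N.
Let B r w : int := if (w < p)%N then (Q r w)%:Z else
  (-1) ^+ (w - p) * ((p * m + r * (W - p)).+1 + (w - p))%:Z.

Lemma exists_SMA_padded_rows :
    (m * s = c.*2 * L)%N -> (n * k = c.*2 * L)%N ->
    (forall t1 t2, (t1 < c.*2)%N -> (t2 < c.*2)%N ->
       off t1 = off t2 %[mod gcdn m n] -> t1 = t2) ->
    (p <= W)%N -> ~~ odd (W - p) ->
    (forall r w, (r < m)%N -> (w < p)%N -> (0 < Q r w <= p * m)%N) ->
    (forall r1 w1 r2 w2, (r1 < m)%N -> (w1 < p)%N -> (r2 < m)%N -> (w2 < p)%N ->
       Q r1 w1 = Q r2 w2 -> r1 = r2 /\ w1 = w2) ->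
    (forall r, (r < m)%N ->
       (\sum_(w < p) Q ((r + e) %% m) w = \sum_(w < p) Q r w)%N) ->
  exists A : pf_array m n, is_SMA s k A.
Proof.
move=> ms nk off_inj le_pW evenWp Q_bound Q_inj Q_sum.
have absB r w : `|B r w|%N = if (w < p)%N then Q r w else
    ((p * m + r * (W - p)).+1 + (w - p))%N.
  by rewrite /B; case: ifP => // _; rewrite abszM abszX exp1n mul1n.
(* The padding of row r uses the block of W - p integers that follows p * m + r * (W - p), above the
   range of [Q]. *)
have pad_bound r w : (r < m)%N -> (w < W)%N -> (p <= w)%N ->
    (p * m < (p * m + r * (W - p)).+1 + (w - p) <= m * W)%N.
  move=> lt_rm lt_wW le_pw;
    have : (r.+1 * (W - p) <= m * (W - p))%N by rewrite leq_mul2r lt_rm orbT.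
  by rewrite mulSn mulnBr mulnC; lia.
apply: (exists_SMA_opposite_pairs (c := c) (e := e) (o := o) (B := B)) => //.
- move=> r w lt_rm lt_wW; rewrite absB; case: (ltnP w p) => [lt_wp | le_pw].
    have /andP[-> leQ] := Q_bound r w lt_rm lt_wp.
    by rewrite (leq_trans leQ) // mulnC leq_mul.
  by have /andP[_ ->] := pad_bound r w lt_rm lt_wW le_pw; rewrite andbT.
- move=> r1 w1 r2 w2 lt_rm1 lt_wW1 lt_rm2 lt_wW2; rewrite !absB.
  case: (ltnP w1 p) => [lt_wp1 | le_pw1]; case: (ltnP w2 p) => [lt_wp2 | le_pw2].
  + exact: Q_inj.
  + by have := Q_bound r1 w1 lt_rm1 lt_wp1;
    have := pad_bound r2 w2 lt_rm2 lt_wW2 le_pw2; lia.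
  + by have := Q_bound r2 w2 lt_rm2 lt_wp2;
    have := pad_bound r1 w1 lt_rm1 lt_wW1 le_pw1; lia.
  rewrite !addSn => -[]; rewrite -!addnA => /addnI /euclid_inj[].
  + exact: ltn_sub2r (leq_ltn_trans le_pw1 lt_wW1) lt_wW1.
  + exact: ltn_sub2r (leq_ltn_trans le_pw2 lt_wW2) lt_wW2.
  by move=> -> /(congr1 (addn^~ p)); rewrite !subnK.
move=> r lt_rm.
have sumB r1 : \sum_(w < W) B r1 w = (\sum_(w < p) Q r1 w)%N%:Z - ((W - p)./2)%:Z.
  rewrite -(big_mkord xpredT (B r1)) (big_cat_nat (leq0n p) le_pW) /= big_mkord.
  have -> : \sum_(p <= w < W) B r1 w = \sum_(w < W - p) B r1 (w + p)%N.
    by rewrite -{1}[p]add0n big_addn big_mkord.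
  rewrite -(sum_alternating (p * m + r1 * (W - p)).+1 evenWp).
  congr (_ + _); last by apply: eq_bigr => w _; rewrite /B ltnNge leq_addl /= addnK.
  by rewrite (big_morph Posz PoszD (erefl _)); apply: eq_bigr => w _;
    rewrite /B ltn_ord.
by rewrite !sumB Q_sum.
Qed.

End PadRows.

(** A magic rectangle: with M = 2h + 1 rows, column w contains wM + 1, ..., (w + 1)M. The first two
    columns add up to r plus a constant, and the third is a constant minus r. *)
Definition magic3 (h r w : nat) : nat :=
  match w with
  | 0 => (uphalf r + (if odd r then h.+1 else 1))%N
  | 1 => (h.*2.+1 + uphalf r + (if odd r then 0 else h.+1))%N
  | _ => (3 * h.*2.+1 - r)%N
  end.

Lemma magic3_bound h r w : (r < h.*2.+1)%N -> (w < 3)%N ->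
  (0 < magic3 h r w <= 3 * h.*2.+1)%N.
Proof.
by move=> lt_r; case: w => [|[|[|w]]] // _ /=; case: (boolP (odd r)); lia.
Qed.

Lemma magic3_inj h r1 w1 r2 w2 :
    (r1 < h.*2.+1)%N -> (w1 < 3)%N -> (r2 < h.*2.+1)%N -> (w2 < 3)%N ->
  magic3 h r1 w1 = magic3 h r2 w2 -> r1 = r2 /\ w1 = w2.
Proof.
move=> lt_r1 + lt_r2; case: w1 => [|[|[|w1]]] // _; case: w2 => [|[|[|w2]]] // _ /=;
  case: (boolP (odd r1)) => odd1; case: (boolP (odd r2)) => odd2; lia.
Qed.

Lemma sum_magic3 h r : (r < h.*2.+1)%N ->
  (\sum_(w < 3) magic3 h r w = 4 * h.*2.+1 + h + 2)%N.
Proof.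
by move=> lt_r; rewrite !big_ord_recr big_ord0 /=; case: ifP; lia.
Qed.

(* {1, 3, 7}, {2, 4, 5}, {6, 10, 12}, {8, 9, 11} partition {1, ..., 12};
   the first two have equal sums, and so do the last two. *)
Definition twelve (b top : bool) (w : nat) : nat :=
  match b, top with
  | false, true => nth 0 [:: 1; 3; 7] w
  | false, false => nth 0 [:: 2; 4; 5] w
  | true, true => nth 0 [:: 6; 10; 12] w
  | true, false => nth 0 [:: 8; 9; 11] w
  end.

(** For h even and even r < h, the rows r, r + 1, r + h and r + h + 1 share twelve consecutive
    integers, and rows r and r + h have equal sums. *)
Definition twelve_rows (h r w : nat) : nat :=
  (12 * (r %% h)./2 + twelve (odd (r %% h)) (r < h)%N w)%N.

Lemma twelve_rows_bound h r w : ~~ odd h -> (r < h.*2)%N -> (w < 3)%N ->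
  (0 < twelve_rows h r w <= 3 * h.*2)%N.
Proof.
move=> even_h lt_r lt_w; have h_gt0 : (0 < h)%N by lia.
have := ltn_pmod r h_gt0; rewrite /twelve_rows.
have : (0 < twelve (odd (r %% h)) (r < h)%N w <= 12)%N.
  by case: odd; case: (r < h)%N; move: w lt_w => [|[|[|]]].
lia.
Qed.

Lemma twelve_rows_inj h r1 w1 r2 w2 : ~~ odd h ->
    (r1 < h.*2)%N -> (w1 < 3)%N -> (r2 < h.*2)%N -> (w2 < 3)%N ->
  twelve_rows h r1 w1 = twelve_rows h r2 w2 -> r1 = r2 /\ w1 = w2.
Proof.
move=> even_h lt_r1 lt_w1 lt_r2 lt_w2; have h_gt0 : (0 < h)%N by lia.
have twelveE b1 t1 b2 t2 : twelve b1 t1 w1 = twelve b2 t2 w2 ->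
    [/\ b1 = b2, t1 = t2 & w1 = w2].
  by move: b1 t1 b2 t2 w1 w2 lt_w1 lt_w2 => [] [] [] [] [|[|[|]]] // [|[|[|]]].
have twelve_bound b t w : (w < 3)%N -> (0 < twelve b t w <= 12)%N.
  by move: b t w => [] [] [|[|[|]]].
rewrite /twelve_rows => eq12.
have := twelve_bound (odd (r1 %% h)) (r1 < h)%N w1 lt_w1.
have := twelve_bound (odd (r2 %% h)) (r2 < h)%N w2 lt_w2.
move=> bd2 bd1; have eq_q : ((r1 %% h)./2 = (r2 %% h)./2)%N by lia.
move: eq12; rewrite eq_q => /addnI/twelveE[eq_odd eq_top eq_w]; split=> //.
have eq_mod : (r1 %% h = r2 %% h)%N.
  by rewrite -[LHS]odd_double_half -[RHS]odd_double_half eq_odd eq_q.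
have modE r : (r < h.*2)%N -> (r %% h = if r < h then r else r - h)%N.
  move=> lt_r; case: ifP => [/modn_small // | /negbT]; rewrite -leqNgt => le_hr.
  by rewrite -{1}(subnK le_hr) modnDr modn_small //; lia.
by move: eq_mod eq_top; rewrite (modE _ lt_r1) (modE _ lt_r2); case: (ltnP r1 h);
  case: (ltnP r2 h) => //; lia.
Qed.

Lemma sum_twelve_rows h r : (0 < h)%N -> (r < h.*2)%N ->
  (\sum_(w < 3) twelve_rows h ((r + h) %% h.*2) w =
   \sum_(w < 3) twelve_rows h r w)%N.
Proof.
move=> h_gt0 lt_r; rewrite !big_ord_recr !big_ord0 /= /twelve_rows.
have -> : (((r + h) %% h.*2) %% h = r %% h)%N.
  by rewrite modn_dvdm ?modnDr // -muln2 dvdn_mulr.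
have -> : ((r + h) %% h.*2 < h)%N = ~~ (r < h)%N.
  case: (ltnP r h) => le_r; first by rewrite modn_small; lia.
  have -> : (r + h = r - h + h.*2)%N by lia.
  by rewrite modnDr modn_small; lia.
by case: odd; case: (r < h)%N; rewrite /=; lia.
Qed.

Lemma half_shift_lt (c d t : nat) : (c.*2 <= d)%N -> (t < c.*2)%N ->
  (t./2 + odd t * d./2 < d)%N.
Proof. by case: (boolP (odd t)); lia. Qed.

Lemma half_shift_inj (c d t1 t2 : nat) : (c.*2 <= d)%N -> ~~ odd d ->
    (t1 < c.*2)%N -> (t2 < c.*2)%N ->
  (t1./2 + odd t1 * d./2 = t2./2 + odd t2 * d./2)%N -> t1 = t2.
Proof. by case: (boolP (odd t1)); case: (boolP (odd t2)); lia. Qed.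

(** * Arrays with an even gcd of s and k *)

Section EvenGcd.

Variables (m n c s k : nat).
Hypotheses (m_gt0 : (0 < m)%N) (n_gt0 : (0 < n)%N).

Let L := lcmn m n.
Let d := gcdn m n.
Let W := (L %/ m * c)%N.

Hypothesis le_cd : (c.*2 <= d)%N.
Hypothesis ms : (m * s = c.*2 * L)%N.
Hypothesis nk : (n * k = c.*2 * L)%N.

Lemma off_inj_small (off : nat -> nat) :
    (forall t, (t < c.*2)%N -> (off t < d)%N) ->
    (forall t1 t2, (t1 < c.*2)%N -> (t2 < c.*2)%N -> off t1 = off t2 -> t1 = t2) ->
  forall t1 t2, (t1 < c.*2)%N -> (t2 < c.*2)%N ->
    off t1 = off t2 %[mod d] -> t1 = t2.
Proof. by move=> lt_off off_inj t1 t2 lt1 lt2; rewrite !modn_small ?lt_off //;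
  apply: off_inj. Qed.

(** With p = 0 each row is an alternating run of even length, so all row sums agree; the adjacent
    diagonals 2t and 2t + 1 are paired. *)
Lemma exists_SMA_even_width : ~~ odd W -> exists A : pf_array m n, is_SMA s k A.
Proof.
move=> evenW;
  apply: (@exists_SMA_padded_rows m n c 1 s k 0 double (fun _ _ => 0)) => //.
- by apply: off_inj_small; lia.
- by rewrite subn0.
Qed.

Hypotheses (oddW : odd W) (W_ge3 : (3 <= W)%N).

Lemma exists_SMA_odd_rows : odd m -> exists A : pf_array m n, is_SMA s k A.
Proof.
move=> odd_m; pose h := m./2;
  have mE : m = h.*2.+1 by rewrite -add1n -[LHS]odd_double_half odd_m.
apply: (@exists_SMA_padded_rows m n c 1 s k 3 double (magic3 h)) => //.
- by apply: off_inj_small; lia.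
- by rewrite oddB // oddW.
- by rewrite mE; apply: magic3_bound.
- by rewrite mE; apply: magic3_inj.
by move=> r lt_rm; rewrite !sum_magic3 -?mE ?ltn_pmod.
Qed.

(** Rows of three that use up 1, ..., 3m cannot have a constant sum for even m, as 3(3m + 1)/2 is
    not an integer. [twelve_rows] gives invariance under m/2 instead. The distance e = L/2 is m/2
    modulo m and d/2 modulo d, because L/m and L/d are odd. *)
Lemma exists_SMA_rows_mod4_0 : (4 %| m)%N -> odd (L %/ m) -> odd (L %/ n) ->
  exists A : pf_array m n, is_SMA s k A.
Proof.
move=> m_mod odd_x odd_y; pose h := m./2.
have mE : m = h.*2 by rewrite /h; lia.
have even_h : ~~ odd h by rewrite /h; lia.
have Lm : L = (L %/ m * m)%N by rewrite divnK ?dvdn_lcml.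
have Ld : L = (L %/ d * d)%N by rewrite divnK // (dvdn_trans (dvdn_gcdl m n)) ?dvdn_lcml.
have L_gt0 : (0 < L)%N by rewrite lcmn_gt0 m_gt0.
have d_gt0 : (0 < d)%N by rewrite gcdn_gt0 m_gt0.
have Ly : L = (L %/ n * n)%N by rewrite divnK ?dvdn_lcmr.
have mdvd : m = (m %/ d * d)%N by rewrite divnK ?dvdn_gcdl.
have LdE : (L %/ d = m %/ d * (L %/ m))%N.
  by rewrite {1}Lm {2}mdvd mulnA mulnK // mulnC.
have eq_mn : (m %/ d = L %/ n)%N.
  apply/eqP; rewrite -(eqn_pmul2r (isT : 0 < 1)%N) !muln1 -(eqn_pmul2r n_gt0) -Ly.
  by rewrite /L /lcmn divn_mulAC ?dvdn_gcdl.
have odd_z : odd (L %/ d) by rewrite LdE oddM eq_mn odd_y.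
have even_d : ~~ odd d.
  have -> : odd d = odd m by rewrite [in RHS]mdvd oddM eq_mn odd_y.
  by rewrite -dvdn2; apply: dvdn_trans m_mod.
have halfL x a : odd x -> ~~ odd a -> ((x * a)./2 = x./2 * a + a./2)%N.
  move=> odd_x1 /even_halfK <-; rewrite -doubleMr !doubleK.
  by rewrite -{1}[x]odd_double_half odd_x1 mulnDl mul1n addnC -doubleMl doubleMr.
apply: (@exists_SMA_padded_rows m n c L./2 s k 3 id (twelve_rows h)) => //.
- have offE t : (t./2 + odd t * L./2 = t./2 + odd t * d./2 %[mod d])%N.
    case: (odd t); rewrite ?mul0n // !mul1n Ld halfL //.
    by rewrite addnCA modnMDl.
  move=> t1 t2 lt1 lt2; rewrite !offE !modn_small ?(half_shift_lt le_cd) //.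
  exact: half_shift_inj le_cd even_d lt1 lt2.
- by rewrite oddB // oddW.
- by rewrite mE => r w; apply: twelve_rows_bound.
- by rewrite mE => r1 w1 r2 w2; apply: twelve_rows_inj.
move=> r lt_rm; have -> : ((r + L./2) %% m = (r + h) %% h.*2)%N.
  rewrite Lm halfL // ?mE ?odd_double // doubleK.
  by rewrite addnCA -mE modnMDl.
by rewrite sum_twelve_rows -?mE // -double_gt0 -mE.
Qed.

(** As m is even, the shift by e = 2 preserves the parity of a row. So two copies of [magic3] serve,
    one per parity, the odd one raised by 3m/2. *)
Lemma exists_SMA_rows_mod4_2 : (m %% 4 = 2)%N -> odd c -> (c.*2 < d)%N ->
  exists A : pf_array m n, is_SMA s k A.
Proof.
move=> m_mod odd_c lt_cd; pose h := (m %/ 4)%N.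
have mE : m = h.*2.+1.*2 by rewrite /h; lia.
have m3 : (3 * m = (3 * h.*2.+1).*2)%N by lia.
pose Q r w := (magic3 h r./2 w + odd r * (3 * h.*2.+1))%N.
have Q_bound r w : (r < m)%N -> (w < 3)%N -> (0 < Q r w <= 3 * m)%N.
  move=> lt_rm lt_w; have : (r./2 < h.*2.+1)%N by lia.
  by move=> /magic3_bound/(_ lt_w); rewrite /Q m3; case: odd; lia.
(* The pairs of offsets are (0, 2), (1, 3), (4, 6), (5, 7), and so on. As c is odd the last one is
   (2c - 2, 2c), which fits because 2c < d. *)
apply: (@exists_SMA_padded_rows m n c 2 s k 3 (fun t => 4 * t./2 + odd t)%N Q) => //.
- apply: off_inj_small => [t lt_t | t1 t2 lt1 lt2].
    by case: (boolP (odd t)); case: (boolP (odd t./2)); lia.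
  case: (boolP (odd t1)); case: (boolP (odd t1./2)); case: (boolP (odd t2));
    case: (boolP (odd t2./2)); lia.
- by rewrite oddB // oddW.
- move=> r1 w1 r2 w2 lt_r1 lt_w1 lt_r2 lt_w2; rewrite /Q.
  have lt_r1' : (r1./2 < h.*2.+1)%N by lia.
  have lt_r2' : (r2./2 < h.*2.+1)%N by lia.
  have := magic3_bound lt_r1' lt_w1;
    have := magic3_bound lt_r2' lt_w2 => bd2 bd1 eq12.
  have eq_odd : odd r1 = odd r2 by move: eq12; case: (odd r1);
    case: (odd r2) => //; lia.
  move: eq12; rewrite eq_odd => /addIn/magic3_inj[] // eq_r ->; split=> //.
  by rewrite -[LHS]odd_double_half -[RHS]odd_double_half eq_r eq_odd.
move=> r lt_rm; rewrite !big_split /= !sum_magic3; [|lia|].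
  suff -> : odd ((r + 2) %% m) = odd r by [].
  by rewrite odd_mod ?mE ?odd_double // oddD addbF.
by have := ltn_pmod (r + 2) m_gt0; rewrite {2}mE; lia.
Qed.

End EvenGcd.

(** * Full arrays with sides 2 mod 4 *)

(** A full 6 x 6 signed magic array, listed row by row. *)
Definition sma66 : seq int := [::
  -11; 13; -16; 18; -14; 10;
  11; 9; -5; -4; 6; -17;
  -2; -8; 7; 1; 14; -12;
  2; -9; 16; 4; -3; -10;
  15; -13; 5; -18; -6; 17;
  -15; 8; -7; -1; 3; 12].

(** The signs repeat the pattern + - - +, and a - (a + 1) - (a + 2) + (a + 3) = 0. *)
Lemma sum_quads (a x : nat) : (4 %| x)%N ->
  \sum_(v < x) (-1) ^+ uphalf v * (a + v)%:Z = 0.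
Proof.
move=> /dvdnP[y ->]; elim: y => [|y IHy]; first by rewrite big_ord0.
have sgn_even : (-1) ^+ y.*2 = 1 :> int by rewrite -mul2n exprM sqrrN !expr1n.
have [half_y uphalf_y] : (y * 4)./2 = y.*2 /\ uphalf (y * 4) = y.*2 by split; lia.
rewrite mulSnr addn4 !big_ord_recr IHy /= half_y uphalf_y !exprS sgn_even; lia.
Qed.

Section Full.

Variables m n : nat.
Hypotheses (m_mod : (m %% 4 = 2)%N) (m_ge6 : (6 <= m)%N).
Hypotheses (n_mod : (n %% 4 = 2)%N) (n_ge6 : (6 <= n)%N).

(** Below the corner, columns 2q and 2q + 1 are opposite, and the signs down a column are those of
    [sum_quads]; to the right, rows and columns exchange roles. Corner, right and bottom use
    successive ranges of absolute values. *)
Definition full_val (i j : nat) : int :=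
  if (6 <= i)%N then
    (-1) ^+ (j + uphalf (i - 6)) *
      ((18 + 3 * (n - 6) + j./2 * (m - 6)).+1 + (i - 6))%:Z
  else if (6 <= j)%N then
    (-1) ^+ (i + uphalf (j - 6)) * ((18 + i./2 * (n - 6)).+1 + (j - 6))%:Z
  else nth 0 sma66 (i * 6 + j).

Lemma sma66_bound x : (x < 36)%N -> (0 < `|nth 0%R sma66 x| <= 18)%N.
Proof.
move=> lt_x;
  have /(all_nthP 0%R) : all (fun y : int => (0 < `|y| <= 18)%N) sma66 by [].
exact.
Qed.

Lemma sma66_inj x y : (x < 36)%N -> (y < 36)%N ->
  nth 0 sma66 x = nth 0 sma66 y -> x = y.
Proof. by move=> lt_x lt_y /eqP; rewrite nth_uniq // => /eqP. Qed.

Lemma abs_full_val i j : `|full_val i j|%N =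
  if (6 <= i)%N then ((18 + 3 * (n - 6) + j./2 * (m - 6)).+1 + (i - 6))%N
  else if (6 <= j)%N then ((18 + i./2 * (n - 6)).+1 + (j - 6))%N
  else `|nth 0%R sma66 (i * 6 + j)|%N.
Proof.
rewrite /full_val; do ?case: ifP => _ //; by rewrite abszM abszX exp1n mul1n.
Qed.

Lemma abs_full_val_bottom i j : (i < m)%N -> (j < n)%N -> (6 <= i)%N ->
  (18 + 3 * (n - 6) < `|full_val i j| <= n./2 * m)%N.
Proof.
move=> lt_im lt_jn le6i; rewrite abs_full_val le6i.
have : (j./2.+1 * (m - 6) <= n./2 * (m - 6))%N by rewrite leq_mul2r; apply/orP;
  right; lia.
rewrite mulSn mulnBr; have : (n./2 * 6 <= n./2 * m)%N by rewrite leq_mul.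
by lia.
Qed.

Lemma abs_full_val_right i j : (j < n)%N -> (i < 6)%N -> (6 <= j)%N ->
  (18 < `|full_val i j| <= 18 + 3 * (n - 6))%N.
Proof.
move=> lt_jn lt_i6 le6j; rewrite abs_full_val (ltn_geF lt_i6) le6j /=.
have : (i./2.+1 * (n - 6) <= 3 * (n - 6))%N by rewrite leq_mul2r; apply/orP; right;
  lia.
by rewrite mulSn; lia.
Qed.

Lemma abs_full_val_corner i j : (i < 6)%N -> (j < 6)%N ->
  (0 < `|full_val i j| <= 18)%N.
Proof.
move=> lt_i6 lt_j6; rewrite /full_val (ltn_geF lt_i6) (ltn_geF lt_j6) /=.
by apply: sma66_bound; lia.
Qed.

(** The absolute value identifies the region and, outside the corner, the pair of lines and the
    position along it. The sign, through [parity], separates the two lines of a pair. *)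
Lemma full_val_inj i1 j1 i2 j2 :
    (i1 < m)%N -> (j1 < n)%N -> (i2 < m)%N -> (j2 < n)%N ->
  full_val i1 j1 = full_val i2 j2 -> i1 = i2 /\ j1 = j2.
Proof.
have parity a b c x y : (0 < x)%N ->
    (-1) ^+ (a + c) * x%:Z = (-1) ^+ (b + c) * y%:Z -> x = y -> odd a = odd b.
  move=> x_gt0 + eq_xy; rewrite -eq_xy -signr_odd -[in RHS]signr_odd !oddD.
  by case: (odd a); case: (odd b); case: (odd c) => //=; lia.
move=> lt_i1 lt_j1 lt_i2 lt_j2 eq_val; have eq_abs := congr1 absz eq_val.
have [le_i1 | gt_i1] := leqP 6 i1; have [le_i2 | gt_i2] := leqP 6 i2.
- have /euclid_inj[||eq_j eq_i6] : (j1./2 * (m - 6) + (i1 - 6) = j2./2 * (m - 6) + (i2 - 6))%N.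
  + by move: eq_abs; rewrite !abs_full_val le_i1 le_i2; lia.
  + by lia.
  + by lia.
  have eq_i : i1 = i2 by lia.
  have : odd j1 = odd j2.
    move: eq_val; rewrite /full_val eq_i le_i2 => /parity-> //.
    by rewrite eq_j.
  by move=> eq_odd; split=> //;
    rewrite -[LHS]odd_double_half -[RHS]odd_double_half eq_odd eq_j.
- have := abs_full_val_bottom lt_i1 lt_j1 le_i1.
  have [le_j2 | gt_j2] := leqP 6 j2;
    first by have := abs_full_val_right lt_j2 gt_i2 le_j2; lia.
  by have := abs_full_val_corner gt_i2 gt_j2; lia.
- have := abs_full_val_bottom lt_i2 lt_j2 le_i2.
  have [le_j1 | gt_j1] := leqP 6 j1;
    first by have := abs_full_val_right lt_j1 gt_i1 le_j1; lia.
  by have := abs_full_val_corner gt_i1 gt_j1; lia.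
have [le_j1 | gt_j1] := leqP 6 j1; have [le_j2 | gt_j2] := leqP 6 j2.
- have /euclid_inj[||eq_i eq_j6] : (i1./2 * (n - 6) + (j1 - 6) = i2./2 * (n - 6) + (j2 - 6))%N.
  + by move: eq_abs;
    rewrite !abs_full_val (ltn_geF gt_i1) (ltn_geF gt_i2) le_j1 le_j2; lia.
  + by lia.
  + by lia.
  have eq_j : j1 = j2 by lia.
  have : odd i1 = odd i2.
    move: eq_val;
      rewrite /full_val eq_j (ltn_geF gt_i1) (ltn_geF gt_i2) le_j2 /= => /parity-> //.
    by rewrite eq_i.
  by move=> eq_odd; split=> //;
    rewrite -[LHS]odd_double_half -[RHS]odd_double_half eq_odd eq_i.
- have := abs_full_val_right lt_j1 gt_i1 le_j1.
  by have := abs_full_val_corner gt_i2 gt_j2; lia.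
- have := abs_full_val_right lt_j2 gt_i2 le_j2.
  by have := abs_full_val_corner gt_i1 gt_j1; lia.
move: eq_val;
  rewrite /full_val (ltn_geF gt_i1) (ltn_geF gt_i2) (ltn_geF gt_j1) (ltn_geF gt_j2) /=.
by move/sma66_inj; lia.
Qed.

Lemma sum_sma66_row i : (i < 6)%N -> \sum_(j < 6) nth 0 sma66 (i * 6 + j) = 0.
Proof. by case: i => [|[|[|[|[|[|i]]]]]] // _; rewrite !big_ord_recr big_ord0. Qed.

Lemma sum_sma66_col j : (j < 6)%N -> \sum_(i < 6) nth 0 sma66 (i * 6 + j) = 0.
Proof. by case: j => [|[|[|[|[|[|j]]]]]] // _; rewrite !big_ord_recr big_ord0. Qed.

Lemma sum_split6 (x : nat) (F : nat -> int) : (6 <= x)%N ->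
  \sum_(j < x) F j = \sum_(j < 6) F j + \sum_(j < x - 6) F (j + 6)%N.
Proof.
move=> le6x;
  rewrite -(big_mkord xpredT F) (big_cat_nat (leq0n 6) le6x) /= big_mkord.
by congr (_ + _); rewrite -{1}[6%N]add0n big_addn big_mkord.
Qed.

Lemma sum_full_row i : \sum_(j < n) full_val i j = 0.
Proof.
case: (leqP 6 i) => [le6i | lt_i6].
  rewrite /full_val le6i; set a := (18 + 3 * (n - 6))%N;
    have -> : n = n./2.*2 by lia.
  rewrite (big_ord_double _ (fun j => (-1) ^+ (j + uphalf (i - 6)) *
      ((a + j./2 * (m - 6)).+1 + (i - 6))%:Z)) big1 // => t _.
  by rewrite addSn exprS /= doubleK uphalf_double mulN1r mulNr subrr.
rewrite (sum_split6 (full_val i) n_ge6).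
have -> : \sum_(j < 6) full_val i j = 0.
  rewrite -[RHS](sum_sma66_row lt_i6); apply: eq_bigr => j _.
  by rewrite /full_val (ltn_geF lt_i6) (ltn_geF (ltn_ord j)).
rewrite add0r; set a := (18 + i./2 * (n - 6)).+1.
transitivity ((-1) ^+ i * \sum_(v < n - 6) (-1) ^+ uphalf v * (a + v)%:Z);
  last first.
  by rewrite sum_quads ?mulr0 //; lia.
rewrite mulr_sumr; apply: eq_bigr => v _.
by rewrite /full_val (ltn_geF lt_i6) leq_addl addnK exprD mulrA.
Qed.

Lemma sum_full_col j : \sum_(i < m) full_val i j = 0.
Proof.
rewrite (sum_split6 (full_val^~ j) m_ge6).
have -> : \sum_(i < m - 6) full_val (i + 6) j = 0.
  set a := (18 + 3 * (n - 6) + j./2 * (m - 6)).+1.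
  transitivity ((-1) ^+ j * \sum_(v < m - 6) (-1) ^+ uphalf v * (a + v)%:Z);
    last first.
    by rewrite sum_quads ?mulr0 //; lia.
  rewrite mulr_sumr; apply: eq_bigr => v _.
  by rewrite /full_val leq_addl addnK exprD mulrA.
rewrite addr0; case: (leqP 6 j) => [le6j | lt_j6].
  by rewrite /full_val le6j !big_ord_recr big_ord0 /= !exprD !exprS expr0 /=; lia.
rewrite -[RHS](sum_sma66_col lt_j6); apply: eq_bigr => i _.
by rewrite /full_val (ltn_geF (ltn_ord i)) (ltn_geF lt_j6).
Qed.

Lemma exists_SMA_full : exists A : pf_array m n, is_SMA n m A.
Proof.
have big_fst (R : Type) (idx : R) (op : Monoid.com_law idx) (F : nat -> nat -> R) i :
    \big[op/idx]_(p : 'I_m * 'I_n | p.1 == i) F p.1 p.2 = \big[op/idx]_(j < n) F i j.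
  rewrite -(big_pred1_eq op i (fun i : 'I_m => \big[op/idx]_(j < n) F i j)) pair_big /=.
  by apply: eq_bigl => p; rewrite andbT.
have big_snd (R : Type) (idx : R) (op : Monoid.com_law idx) (F : nat -> nat -> R) j :
    \big[op/idx]_(p : 'I_m * 'I_n | p.2 == j) F p.1 p.2 = \big[op/idx]_(i < m) F i j.
  rewrite -(big_pred1_eq op j (fun j : 'I_n => \big[op/idx]_(i < m) F i j)).
  rewrite exchange_big pair_big /=.
  by apply: eq_bigl => p.
exists (cell_array fst snd (fun p : 'I_m * 'I_n => full_val p.1 p.2)).
apply: is_SMA_cells.
- by move=> [i1 j1] [i2 j2].
- by rewrite card_prod !card_ord mulnC.
- by move=> [i1 j1] [i2 j2] /= /full_val_inj[] // /val_inj-> /val_inj->.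
- move=> [i j] /=; rewrite /sma_support !divn2 oddM.
  have -> : odd n && odd m = false by lia.
  have -> : ((n * m)./2 = n./2 * m)%N by rewrite -{1}[n]odd_double_half (_ : odd n = false) -?doubleMl ?doubleK //; lia.
  rewrite -absz_gt0.
  have le1 : (18 + 3 * (n - 6) <= n./2 * m)%N.
    by have : (n./2 * 6 <= n./2 * m)%N; [rewrite leq_mul | lia].
  have [le6i | lt_i6] := leqP 6 i.
    by have /andP[] := abs_full_val_bottom (ltn_ord i) (ltn_ord j) le6i; lia.
  have [le6j | lt_j6] := leqP 6 j.
    by have /andP[] := abs_full_val_right (ltn_ord j) lt_i6 le6j; lia.
  by have /andP[] := abs_full_val_corner lt_i6 lt_j6; lia.
- by move=> i;
  rewrite -sum1dep_card (big_fst _ _ _ (fun _ _ => 1%N)) sum1_card card_ord.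
- by move=> i;
  rewrite -sum1dep_card (big_snd _ _ _ (fun _ _ => 1%N)) sum1_card card_ord.
- by move=> i; rewrite (big_fst _ _ _ full_val) sum_full_row.
- by move=> j; rewrite (big_snd _ _ _ full_val) sum_full_col.
Qed.

End Full.

(** * Fillings of cyclic diagonals *)

(* Y j t is the entry in row j + t and column j of an L x L square, indices being
   taken mod L. Row i + c is used in [scheme_row] to avoid subtractions. *)
Record cyclic_scheme (L c : nat) (Y : nat -> nat -> int) : Prop := CyclicScheme {
  scheme_periodic : forall j t, Y (j + L)%N t = Y j t;
  scheme_support : forall j t, (j < L)%N -> (t < c)%N -> sma_support (c * L) (Y j t);
  scheme_inj : forall j1 t1 j2 t2,
    (j1 < L)%N -> (t1 < c)%N -> (j2 < L)%N -> (t2 < c)%N ->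
    Y j1 t1 = Y j2 t2 -> j1 = j2 /\ t1 = t2;
  scheme_col : forall j, \sum_(t < c) Y j t = 0;
  scheme_row : forall i, \sum_(t < c) Y (i + (c - t))%N t = 0
}.

(** Row r of the array collects the rows of the L x L square that are r modulo m, each with sum
    0. *)
Lemma cyclic_scheme_SMA (m n c s k : nat) (Y : nat -> nat -> int) :
    (0 < m)%N -> (0 < n)%N -> (c <= gcdn m n)%N ->
    (m * s = c * lcmn m n)%N -> (n * k = c * lcmn m n)%N ->
    cyclic_scheme (lcmn m n) c Y ->
  exists A : pf_array m n, is_SMA s k A.
Proof.
move=> m_gt0 n_gt0 le_cd ms nk [perY supY injY colY rowY].
apply: (exists_SMA_cyclic (c := c) (off := id) (Y := Y)) => //.
- by move=> t1 t2 lt1 lt2; rewrite !modn_small ?(leq_trans _ le_cd).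
have [x Lx] : exists x, lcmn m n = (x * m)%N by exact/dvdnP/dvdn_lcml.
have L_gt0 : (0 < lcmn m n)%N by rewrite lcmn_gt0 m_gt0.
have perYM j t x1 : Y (j + x1 * lcmn m n)%N t = Y j t.
  by elim: x1 => [|x1 IHx]; rewrite ?addn0 // mulSnr addnA perY.
move=> r lt_rm.
(* By periodicity this is the entry of row i on diagonal t, in column i - t; the multiple of the
   period avoids truncated subtraction. *)
pose F t i := Y (i + (c * lcmn m n - c) + (c - t))%N t.
transitivity (\sum_(t < c) \sum_(l < x) F t (l * m + r)%N); last first.
  by rewrite exchange_big big1 // => l _; rewrite rowY.
apply: eq_bigr => t _; rewrite -(big_ord_modn_shift _ t lt_rm) => [|j].
  rewrite -Lx; apply: eq_bigr => j _; rewrite /F -[LHS](perYM _ _ c); congr (Y _ _).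
  have : (c <= c * lcmn m n)%N by rewrite leq_pmulr.
  by have := ltn_ord t; lia.
by rewrite -Lx /F -[RHS]perY; congr (Y _ _); lia.
Qed.

Lemma succ_modn_inj (L j1 j2 : nat) : (j1 < L)%N -> (j2 < L)%N ->
  (j1.+1 %% L = j2.+1 %% L)%N -> j1 = j2.
Proof.
by move=> lt1 lt2 /eqP;
  rewrite -(addn1 j1) -(addn1 j2) eqn_modDr !modn_small // => /eqP.
Qed.

(** * Adding four diagonals *)

Section AddFour.

Variables (L c : nat) (Y : nat -> nat -> int).
Hypothesis L_gt0 : (0 < L)%N.

Let half := (c * L)./2.
Let a (j : nat) : int := (half + j %% L).+1.
Let b (j : nat) : int := (half + (L.*2 - j %% L))%N.

Definition add_four (j t : nat) : int :=
  if (t < c)%N then Y j t else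
  match (t - c)%N with
  | 0 => a j
  | 1 => - a j.+1
  | 2 => b j
  | _ => - b j.+1
  end.

(** In a row each new entry meets its opposite; in a column the total is (a_j + b_j) - (a_(j+1) +
    b_(j+1)), the difference of two equal constants. Together [a] and [b] fill the 2L absolute
    values above [half]. *)
Lemma cyclic_scheme_add_four : cyclic_scheme L c Y -> cyclic_scheme L (c + 4) add_four.
Proof.
move=> [perY supY injY colY rowY].
have abE j : a j + b j = (half.*2 + L.*2).+1.
  by rewrite /a /b; have := ltn_pmod j L_gt0; lia.
have half4 : ((c + 4) * L)./2 = (half + L.*2)%N by rewrite mulnDl /half; lia.
have half_lt j t : (j < L)%N -> (c <= t)%N -> (half < `|add_four j t| <= half + L.*2)%N.
  move=> lt_jL le_ct; rewrite /add_four (leq_gtF le_ct).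
  have := ltn_pmod j L_gt0; have := ltn_pmod j.+1 L_gt0.
  by case: (t - c)%N => [|[|[|t1]]]; rewrite /a /b; lia.
have le_half j t : (j < L)%N -> (t < c)%N -> (`|Y j t| <= half)%N.
  move=> lt_jL lt_tc; have := supY j t lt_jL lt_tc.
  by rewrite /sma_support /half !divn2; case: ifP; lia.
have addE j t : (t < c)%N -> add_four j t = Y j t by rewrite /add_four => ->.
have addE4 j t : add_four j (c + t) =
    match t with 0 => a j | 1 => - a j.+1 | 2 => b j | _ => - b j.+1 end.
  by rewrite /add_four (leq_gtF (leq_addr _ _)) addKn.
split.
- move=> j t; rewrite /add_four perY; case: ifP => // _.
  by rewrite /a /b -(addSn j L) !modnDr.
- move=> j t lt_jL lt_t; have [lt_tc | le_ct] := ltnP t c.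
    rewrite addE //; have := supY j t lt_jL lt_tc;
      rewrite /sma_support !divn2 half4.
    rewrite mulnDl oddD (oddM 4) andFb addbF.
    by case: ifP => _; rewrite /half; lia.
  have := half_lt j t lt_jL le_ct; rewrite /sma_support !divn2 half4.
  by case: ifP => odd_cL; rewrite -?absz_gt0; lia.
- move=> j1 t1 j2 t2 lt_j1 lt_t1 lt_j2 lt_t2.
  have [lt_tc1 | le_ct1] := ltnP t1 c; have [lt_tc2 | le_ct2] := ltnP t2 c.
  + by rewrite !addE //; apply: injY.
  + by rewrite addE // => eqY; have := half_lt _ _ lt_j2 le_ct2;
    have := le_half _ _ lt_j1 lt_tc1; lia.
  + by rewrite [RHS]addE // => eqY; have := half_lt _ _ lt_j1 le_ct1;
    have := le_half _ _ lt_j2 lt_tc2; lia.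
  have := ltn_pmod j1.+1 L_gt0; have := ltn_pmod j2.+1 L_gt0.
  have := succ_modn_inj lt_j1 lt_j2;
    rewrite /add_four (leq_gtF le_ct1) (leq_gtF le_ct2) /a /b (modn_small lt_j1) (modn_small lt_j2).
  move: lt_t1 lt_t2; rewrite -{1 3}(subnKC le_ct1) -{1 3}(subnKC le_ct2) !ltn_add2l.
  by case: (t1 - c)%N => [|[|[|[|x1]]]] // _;
    case: (t2 - c)%N => [|[|[|[|x2]]]] // _; lia.
- move=> j; rewrite big_split_ord /= (eq_bigr (fun t : 'I_c => Y j t)) => [|t _];
  last by rewrite addE.
  rewrite colY !big_ord_recr big_ord0 /= !addE4.
  by have := abE j; have := abE j.+1; lia.
move=> i;
  rewrite big_split_ord /= (eq_bigr (fun t : 'I_c => Y (i + 4 + (c - t))%N t)) => [|t _]; last first.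
  by rewrite addE //; congr (Y _ _); have := ltn_ord t; lia.
rewrite rowY !big_ord_recr big_ord0 /= !addE4 !subnDl.
by rewrite !addnS !addn0; lia.
Qed.

End AddFour.

Lemma cyclic_scheme_mod4 (L c : nat) : (0 < L)%N ->
    (exists Y, cyclic_scheme L c Y) ->
  forall x, exists Y, cyclic_scheme L (c + 4 * x) Y.
Proof.
move=> L_gt0 scheme_c; elim=> [|x [Y schemeY]]; first by rewrite addn0.
by rewrite mulnS addnCA addnC; exists (add_four L (c + 4 * x) Y);
  apply: cyclic_scheme_add_four.
Qed.

(** * Telescoping patterns of widths three and five *)

Section Bases.

Variable L : nat.
Hypothesis L_gt0 : (0 < L)%N.

Let next (j : nat) : nat := if (j.+1 == L)%N then 0 else j.+1.

Lemma next_lt j : (j < L)%N -> (next j < L)%N.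
Proof. by rewrite /next; case: eqP => [_ // | ]; lia. Qed.

Lemma next_modn j : (j.+1 %% L = next (j %% L))%N.
Proof.
rewrite /next -addn1 -modnDml addn1; case: eqP => [-> | neq]; first exact: modnn.
by rewrite modn_small //; have := ltn_pmod j L_gt0; lia.
Qed.

Lemma next_inj j1 j2 : (j1 < L)%N -> (j2 < L)%N -> next j1 = next j2 -> j1 = j2.
Proof. by rewrite /next; case: eqP; case: eqP; lia. Qed.

Definition seq_inj (f : nat -> int) :=
  forall j1 j2, (j1 < L)%N -> (j2 < L)%N -> f j1 = f j2 -> j1 = j2.

Lemma seq_inj_next f : seq_inj f -> seq_inj (f \o next).
Proof.
by move=> f_inj j1 j2 lt1 lt2 /f_inj-/(_ (next_lt lt1) (next_lt lt2))/next_inj->.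
Qed.

(** Diagonals keep to disjoint intervals, so equal entries lie on one diagonal, where injectivity is
    assumed. *)
Lemma blocks_inj (c : nat) (lo hi : nat -> int) (X : nat -> nat -> int) :
    (forall j t, (j < L)%N -> (t < c)%N -> lo t <= X j t <= hi t) ->
    (forall t1 t2, (t1 < t2 < c)%N -> (hi t1 < lo t2) || (hi t2 < lo t1)) ->
    (forall t, (t < c)%N -> seq_inj (X^~ t)) ->
  forall j1 t1 j2 t2, (j1 < L)%N -> (t1 < c)%N -> (j2 < L)%N -> (t2 < c)%N ->
    X j1 t1 = X j2 t2 -> j1 = j2 /\ t1 = t2.
Proof.
move=> bound disj inj j1 t1 j2 t2 lt_j1 lt_t1 lt_j2 lt_t2 eqX.
have bd1 := bound _ _ lt_j1 lt_t1; have bd2 := bound _ _ lt_j2 lt_t2.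
have eq_t : t1 = t2.
  have [lt12 | lt21 | //] := ltngtP t1 t2.
    have lt12c : (t1 < t2 < c)%N by rewrite lt12.
    by have := disj _ _ lt12c; lia.
  have lt21c : (t2 < t1 < c)%N by rewrite lt21.
  by have := disj _ _ lt21c; lia.
by split=> //; apply: (inj t1) => //; rewrite eqX eq_t.
Qed.

Section Width3.

Variables (u : nat -> int) (k0 k1 k2 : int) (lo hi : nat -> int).

Let X (j t : nat) : int :=
  match t with
  | 0 => k0 + u j
  | 1 => k1 - (u j + u (next j))
  | _ => k2 + u (next j)
  end.

(** A column reads u_j, -(u_j + u_(j+1)), u_(j+1). Along a row the column index drops by one per
    diagonal, which gives u_(j+1), -(u_j + u_(j+1)), u_j. Both cancel. *)
Lemma cyclic_scheme3 :
    k0 + k1 + k2 = 0 ->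
    (forall j t, (j < L)%N -> (t < 3)%N ->
       sma_support (3 * L) (X j t) && (lo t <= X j t <= hi t)) ->
    (forall t1 t2, (t1 < t2 < 3)%N -> (hi t1 < lo t2) || (hi t2 < lo t1)) ->
    seq_inj u -> seq_inj (fun j => u j + u (next j)) ->
  cyclic_scheme L 3 (fun j => X (j %% L)).
Proof.
move=> k_sum bound disj u_inj w_inj; split.
- by move=> j t; rewrite modnDr.
- by move=> j t lt_j lt_t; rewrite modn_small //; case/andP: (bound j t lt_j lt_t).
- move=> j1 t1 j2 t2 lt_j1 lt_t1 lt_j2 lt_t2; rewrite !modn_small //.
  apply: (blocks_inj (c := 3) (lo := lo) (hi := hi)) => //.
    by move=> j t lt_j lt_t; case/andP: (bound j t lt_j lt_t).
  move=> [|[|[|//]]] _ i1 i2 lt_i1 lt_i2 /=.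
  + by move/addrI/u_inj->.
  + by move/addrI/oppr_inj/w_inj->.
  + by move/addrI/(seq_inj_next u_inj)->.
- by move=> j; rewrite !big_ord_recr big_ord0 /=; lia.
move=> i; rewrite !big_ord_recr big_ord0 /= !subSS !subn0 !addnS !addn0.
by rewrite -!next_modn; lia.
Qed.

End Width3.

Section Width5.

Variables (u v f : nat -> int) (k : nat -> int) (lo hi : nat -> int).

Let X (j t : nat) : int :=
  match t with
  | 0 => k 0%N + u j
  | 1 => k 1%N - (u j + u (next j) + f j)
  | 2 => k 2%N + (u (next j) + v j + f (next j) + f j)
  | 3 => k 3%N - (v (next j) + v j + f (next j))
  | _ => k 4%N + v (next j)
  end.

(** Three overlapping copies of the pattern of width three: [u] on diagonals 0 to 2, -f on 1 to 3
    and [v] on 2 to 4. *)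
Lemma cyclic_scheme5 :
    \sum_(t < 5) k t = 0 ->
    (forall j t, (j < L)%N -> (t < 5)%N ->
       sma_support (5 * L) (X j t) && (lo t <= X j t <= hi t)) ->
    (forall t1 t2, (t1 < t2 < 5)%N -> (hi t1 < lo t2) || (hi t2 < lo t1)) ->
    seq_inj u -> seq_inj v -> seq_inj (fun j => u j + u (next j) + f j) ->
    seq_inj (fun j => u (next j) + v j + f (next j) + f j) ->
    seq_inj (fun j => v (next j) + v j + f (next j)) ->
  cyclic_scheme L 5 (fun j => X (j %% L)).
Proof.
rewrite !big_ord_recr big_ord0 /= => k_sum bound disj u_inj v_inj w1_inj w2_inj w3_inj; split.
- by move=> j t; rewrite modnDr.
- by move=> j t lt_j lt_t; rewrite modn_small //; case/andP: (bound j t lt_j lt_t).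
- move=> j1 t1 j2 t2 lt_j1 lt_t1 lt_j2 lt_t2; rewrite !modn_small //.
  apply: (blocks_inj (c := 5) (lo := lo) (hi := hi)) => //.
    by move=> j t lt_j lt_t; case/andP: (bound j t lt_j lt_t).
  move=> [|[|[|[|[|//]]]]] _ i1 i2 lt_i1 lt_i2 /=.
  + by move/addrI/u_inj->.
  + by move/addrI/oppr_inj/w1_inj->.
  + by move/addrI/w2_inj->.
  + by move/addrI/oppr_inj/w3_inj->.
  + by move/addrI/(seq_inj_next v_inj)->.
- by move=> j; rewrite !big_ord_recr big_ord0 /=; lia.
move=> i; rewrite !big_ord_recr big_ord0 /= !subSS !subn0 !addnS !addn0.
by rewrite -!next_modn; lia.
Qed.

End Width5.

End Bases.

(** * Explicit sequences *)

Lemma sma_supportI (N : nat) (x : int) :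
  (`|x| <= N./2)%N -> odd N || (x != 0) -> sma_support N x.
Proof. by rewrite /sma_support !divn2; case: ifP => /=; lia. Qed.

(** The sequence -h, 1, 1 - h, 2, ..., h, 0 permutes -h, ..., h, and so do its cyclic sums of
    neighbours 1 - h, 2 - h, ..., h, -h. *)
Definition zigzag (h j : nat) : int := if odd j then (uphalf j)%:Z else (j./2)%:Z - h%:Z.

Lemma zigzag_inj h : seq_inj h.*2.+1 (zigzag h).
Proof. by move=> j1 j2 lt1 lt2; rewrite /zigzag; do 2!case: ifP => ?; lia. Qed.

Lemma zigzag_bound h j : (j < h.*2.+1)%N -> - h%:Z <= zigzag h j <= h.
Proof. by rewrite /zigzag => lt_j; case: ifP; lia. Qed.

Local Notation next L j := (if j.+1 == L then 0 else j.+1)%N.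

Lemma zigzag_sum h j : (j < h.*2.+1)%N ->
  zigzag h j + zigzag h (next h.*2.+1 j) = if j == h.*2 then - h%:Z else j.+1%:Z - h%:Z.
Proof.
rewrite /zigzag eqSS => lt_j; case: eqP => [-> | neq] /=.
  by rewrite odd_double doubleK; lia.
by case: (boolP (odd j)) => ? /=; lia.
Qed.

Lemma zigzag_sum_inj h : seq_inj h.*2.+1 (fun j => zigzag h j + zigzag h (next h.*2.+1 j)).
Proof.
by move=> j1 j2 lt1 lt2; rewrite !zigzag_sum //; do 2!case: eqP => ?; lia.
Qed.

Lemma zigzag_sum_bound h j : (j < h.*2.+1)%N ->
  - h%:Z <= zigzag h j + zigzag h (next h.*2.+1 j) <= h.
Proof. by move=> lt_j; rewrite zigzag_sum //; case: eqP; lia. Qed.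

Lemma scheme3_odd h : exists Y, cyclic_scheme h.*2.+1 3 Y.
Proof.
pose L : int := h.*2.+1; have LE : L = h.*2.+1 :> int by [].
(* The diagonals fill the intervals of radius h around -L, 0 and L, which tile Omega. *)
eexists; apply: (@cyclic_scheme3 h.*2.+1 isT (zigzag h) (- L) 0 L
  (nth 0 [:: - L - h%:Z; - h%:Z; L - h%:Z]) (nth 0 [:: - L + h%:Z; h%:Z; L + h%:Z])).
- by lia.
- move=> j t lt_j; have lt_j' : (next h.*2.+1 j < h.*2.+1)%N by case: eqP; lia.
  have := zigzag_bound lt_j; have := zigzag_bound lt_j';
    have := zigzag_sum_bound lt_j.
  move: (zigzag h j) (zigzag h (next _ _)) => {lt_j'} x y bd1 bd2 bd3;
    case: t => [|[|[|//]]] _ /=; (apply/andP; split; first apply: sma_supportI);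
      lia.
- by move=> [|[|[|t1]]] [|[|[|t2]]] //=; lia.
- exact: zigzag_inj.
exact: zigzag_sum_inj.
Qed.

Lemma scheme5_odd h : exists Y, cyclic_scheme h.*2.+1 5 Y.
Proof.
pose L : int := h.*2.+1; have LE : L = h.*2.+1 :> int by [].
eexists; apply: (@cyclic_scheme5 h.*2.+1 isT (zigzag h) (zigzag h) (fun=> 0)
  (fun t => L * (t%:Z - 2%:Z)) (fun t => L * (t%:Z - 2%:Z) - h%:Z) (fun t => L * (t%:Z - 2%:Z) + h%:Z)).
- by rewrite !big_ord_recr big_ord0 /=; lia.
- move=> j t lt_j; have lt_j' : (next h.*2.+1 j < h.*2.+1)%N by case: eqP; lia.
  have := zigzag_bound lt_j; have := zigzag_bound lt_j';
    have := zigzag_sum_bound lt_j.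
  move: (zigzag h j) (zigzag h (next _ _)) => {lt_j'} x y bd1 bd2 bd3;
    case: t => [|[|[|[|[|//]]]]] _ /=; (apply/andP; split;
      first apply: sma_supportI); lia.
- by move=> [|[|[|[|[|t1]]]]] [|[|[|[|[|t2]]]]] //=; lia.
- exact: zigzag_inj.
- exact: zigzag_inj.
- by move=> j1 j2 lt1 lt2; rewrite !addr0; apply: zigzag_sum_inj.
- by move=> j1 j2 lt1 lt2; rewrite !addr0 ![zigzag h (next _ _) + _]addrC;
  apply: zigzag_sum_inj.
- by move=> j1 j2 lt1 lt2; rewrite !addr0 ![zigzag h (next _ _) + _]addrC;
  apply: zigzag_sum_inj.
Qed.

Section Width3Even.

(* The sums w must avoid 1 because 1 - w is the middle diagonal, and 0 is not an
   entry when the number of cells is even. *)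
Variables (h : nat) (u w : nat -> int).
Hypothesis u_inj : seq_inj h.*2 u.
Hypothesis u_bound : forall j, (j < h.*2)%N -> 1 - h%:Z <= u j <= h.
Hypothesis wE : forall j, (j < h.*2)%N -> u j + u (next h.*2 j) = w j.
Hypothesis w_inj : seq_inj h.*2 w.
Hypothesis w_bound : forall j, (j < h.*2)%N -> (1 - h%:Z <= w j <= h%:Z + 1) && (w j != 1).

Lemma scheme3_even_of : (0 < h)%N -> exists Y, cyclic_scheme h.*2 3 Y.
Proof.
move=> h_gt0; have h2_gt0 : (0 < h.*2)%N by lia.
(* The diagonals fill h + 1, ..., 3h, then -h, ..., h without 0, then -3h, ..., -h - 1. *)
eexists; apply: (@cyclic_scheme3 h.*2 h2_gt0 u h.*2%:Z 1 (- h.*2%:Z - 1)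
  (nth 0 [:: h%:Z + 1; - h%:Z; - (3 * h)%:Z]) (nth 0 [:: (3 * h)%:Z; h%:Z; - h%:Z - 1])).
- by lia.
- move=> j t lt_j; have lt_j' : (next h.*2 j < h.*2)%N by case: eqP; lia.
  rewrite wE //.
  have := u_bound lt_j; have := u_bound lt_j'; have := w_bound lt_j.
  move: (u j) (u (next _ _)) (w j) => {lt_j'} x y z bd1 bd2 bd3.
  case: t => [|[|[|//]]] _ /=; (apply/andP; split; first apply: sma_supportI); lia.
- by move=> [|[|[|t1]]] [|[|[|t2]]] //=; lia.
- exact: u_inj.
by move=> j1 j2 lt1 lt2; rewrite !wE //; apply: w_inj.
Qed.

End Width3Even.

(** The sequence starts 1 - h, 1, 2 - h, 2, and the two parities exchange roles at index h.
    Neighbours then add up to j + 2 - h, except for 1 - h at the end and for h + 1 at j = h - 1, in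
    place of the forbidden 1. *)
Lemma scheme3_4even h : (0 < h)%N -> ~~ odd h -> exists Y, cyclic_scheme h.*2 3 Y.
Proof.
move=> h_gt0 even_h.
apply: (@scheme3_even_of h
  (fun j => if odd j == (j < h)%N then (j./2.+1)%:Z else (j./2.+1)%:Z - h%:Z)
  (fun j => if (j == h.-1)%N then h%:Z + 1 else if (j == h.*2.-1)%N then 1 - h%:Z
            else j%:Z + 2%:Z - h%:Z)) => //.
- by move=> j1 j2 lt1 lt2; case: (boolP (odd j1)) => ?; case: (boolP (odd j2)) => ?;
    case: (ltnP j1 h) => ?; case: (ltnP j2 h) => ? /=; lia.
- by move=> j lt_j; case: (boolP (odd j)) => ?; case: (ltnP j h) => ? /=; lia.
- move=> j lt_j; case: (eqVneq j h.-1) => ?; case: (eqVneq j h.*2.-1) => ?;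
    case: (eqVneq j.+1 h.*2) => ?; case: (ltnP j h) => ?; case odd_j: (odd j) => /=;
    rewrite ?h_gt0 /=; case: (ltnP j.+1 h) => ?; rewrite ?odd_j /=; lia.
- by move=> j1 j2 lt1 lt2; do ?case: eqP => ?; lia.
- by move=> j lt_j; do ?case: eqP => ?; lia.
Qed.

(** Even indices carry 1 - h, ..., -1 in order, with (h - 1)/2 inserted at index h - 1; odd indices
    carry 1, ..., h in order without (h - 1)/2, then 0. *)
Lemma scheme3_4odd h : (2 < h)%N -> odd h -> exists Y, cyclic_scheme h.*2 3 Y.
Proof.
move=> h_gt0 odd_h.
apply: (@scheme3_even_of h
  (fun j => if odd j then
      if (j < h - 2)%N then (uphalf j)%:Z
      else if (j < h.*2.-1)%N then (uphalf j).+1%:Z else 0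
    else if (j < h.-1)%N then 1 - h%:Z + (j./2)%:Z
    else if (j < h)%N then (h./2)%:Z else (j./2)%:Z - h%:Z)
  (fun j => if (j < h - 3)%N then j%:Z + 2%:Z - h%:Z
            else if (j < h - 2)%N then 0
            else if (j < h.-1)%N then h%:Z
            else if (j < h)%N then h%:Z + 1
            else if (j < h.*2 - 2)%N then j%:Z + 2%:Z - h%:Z
            else if (j < h.*2.-1)%N then -1 else 1 - h%:Z)); last by lia.
- by move=> j1 j2 lt1 lt2; case: (boolP (odd j1)) => ?; case: (boolP (odd j2)) => ?;
    do ?case: ltnP => ?; lia.
- by move=> j lt_j; case: (boolP (odd j)) => ?; do ?case: ltnP => ?; lia.
- move=> j lt_j; case: (eqVneq j.+1 h.*2) => [eq_j | neq_j] /=.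
    by case: (boolP (odd j)) => ?; do ?case: ltnP => ?; lia.
  by case odd_j: (odd j) => /=; rewrite ?odd_j /=; do ?case: ltnP => ?; lia.
- by move=> j1 j2 lt1 lt2; do ?case: ltnP => ?; lia.
- by move=> j lt_j; do ?case: ltnP => ?; lia.
Qed.

Section Width5Even.

Variable h : nat.
Hypothesis h_ge3 : (2 < h)%N.

(* The sums of consecutive terms of u are h, h + 1, ..., 3h - 2, with 2h - 1
   repeated; f shifts half of them by 1 to make them distinct. v is u with
   its last two odd-indexed terms exchanged, as w2 has a repetition if v = u. *)
Let u (j : nat) : int := if odd j then (h + j./2)%N else j./2.
Let v (j : nat) : int :=
  if (j == h.*2 - 3)%N then h.*2.-1%:Z else if (j == h.*2.-1)%N then (h.*2 - 2)%N%:Z else u j.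
Let f (j : nat) : int := (h.-1 <= j <= h.*2 - 2)%N.
Let w1 (j : nat) : int :=
  if (j < h.-1)%N then (h + j)%N else if (j == h.*2.-1)%N then h.*2.-1 else (h + j).+1.
Let w2 (j : nat) : int :=
  if (j < h - 2)%N then (h + j)%N else if (j == h - 2)%N then h.*2.-1
  else if (j < h.*2 - 3)%N then (h + j).+2
  else if (j == h.*2 - 3)%N then (3 * h)%N else if (j == h.*2 - 2)%N then (3 * h).-1
  else (h.*2 - 2)%N.
Let w3 (j : nat) : int :=
  if (j < h - 2)%N then (h + j)%N else if (j < h.*2 - 4)%N then (h + j).+1
  else if (j == h.*2 - 4)%N then (3 * h - 2)%N else if (j == h.*2 - 3)%N then (3 * h).-1
  else if (j == h.*2 - 2)%N then (3 * h - 3)%N else (h.*2 - 2)%N.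

Lemma width5_u_inj : seq_inj h.*2 u.
Proof. by move=> j1 j2 lt1 lt2; rewrite /u; do 2!case: ifP => ?; lia. Qed.

Lemma width5_v_inj : seq_inj h.*2 v.
Proof.
by move=> j1 j2 lt1 lt2; rewrite /v /u; case: (boolP (odd j1)) => ?;
  case: (boolP (odd j2)) => ?; do ?case: eqP => ?; lia.
Qed.

Lemma width5_u_bound j : (j < h.*2)%N -> 0 <= u j <= h.*2.-1.
Proof. by rewrite /u; case: ifP; lia. Qed.

Lemma width5_v_bound j : (j < h.*2)%N -> 0 <= v j <= h.*2.-1.
Proof. by move=> /width5_u_bound; rewrite /v; do ?case: eqP; lia. Qed.

(** The exchanged terms are the consecutive integers 2h - 2 and 2h - 1, so each changes by one
    only. *)
Lemma width5_vE j : v j = u j + (j == h.*2 - 3)%N%:Z - (j == h.*2.-1)%N%:Z.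
Proof. by rewrite /v /u; case: (boolP (odd j)) => ?; do ?case: eqP => ? /=;
  lia. Qed.

Lemma width5_w1E j : (j < h.*2)%N -> u j + u (next h.*2 j) + f j = w1 j.
Proof.
move=> lt_j; case: (eqVneq j.+1 h.*2) => [eq_j | neq_j].
  have -> : j = h.*2.-1 by lia.
  by rewrite /u /f /w1 /= (_ : odd h.*2.-1); [do ?case: ifP => ? | ]; lia.
rewrite /u /f /w1; case odd_j: (odd j); rewrite /= odd_j /=;
  case: (leqP h.-1 j) => ?; case: (leqP j (h.*2 - 2)) => ? /=; do ?case: ifP => ?;
    lia.
Qed.

Lemma width5_w2E j : (j < h.*2)%N -> u (next h.*2 j) + v j + f (next h.*2 j) + f j = w2 j.
Proof.
move=> lt_j; have := width5_w1E lt_j; rewrite width5_vE; move: (u _) (u j) => x y.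
rewrite /w1 /w2 /f; case: (eqVneq j.+1 h.*2) => ?; do ?case: ifP => ?; lia.
Qed.

Lemma width5_v_sumE j : (j < h.*2)%N ->
  v (next h.*2 j) + v j =
    u (next h.*2 j) + u j + (h.*2 - 4 <= j)%N%:Z - ((h.*2 - 2 <= j)%N : nat).*2%:Z.
Proof.
move=> lt_j; rewrite !width5_vE; move: (u _) (u j) => x y.
case: (eqVneq j.+1 h.*2) => ?; case: (leqP (h.*2 - 4) j) => ? /=;
  do ?case: eqP => ?; lia.
Qed.

Lemma width5_f_next j : (j < h.*2)%N -> f (next h.*2 j) = (h - 2 <= j <= h.*2 - 3)%N.
Proof. by rewrite /f; case: (eqVneq j.+1 h.*2) => ?; lia. Qed.

Lemma width5_w3E j : (j < h.*2)%N -> v (next h.*2 j) + v j + f (next h.*2 j) = w3 j.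
Proof.
move=> lt_j; have := width5_w1E lt_j; rewrite width5_v_sumE // width5_f_next //;
  move: (u _) (u j) => x y.
rewrite /w1 /w3 /f; do ?case: ifP => ?; lia.
Qed.

Lemma width5_w1_inj : seq_inj h.*2 w1.
Proof. by move=> j1 j2 lt1 lt2; rewrite /w1;
  do ?[case: ltnP => ? | case: eqP => ?]; lia. Qed.

Lemma width5_w2_inj : seq_inj h.*2 w2.
Proof. by move=> j1 j2 lt1 lt2; rewrite /w2;
  do ?[case: ltnP => ? | case: eqP => ?]; lia. Qed.

Lemma width5_w3_inj : seq_inj h.*2 w3.
Proof. by move=> j1 j2 lt1 lt2; rewrite /w3;
  do ?[case: ltnP => ? | case: eqP => ?]; lia. Qed.

Lemma width5_w1_bound j : (j < h.*2)%N -> h%:Z <= w1 j <= (3 * h).-1.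
Proof. by rewrite /w1 => lt_j; do ?case: ifP => ?; lia. Qed.

Lemma width5_w2_bound j : (j < h.*2)%N -> (h%:Z <= w2 j <= (3 * h)%N) && (w2 j != h.*2).
Proof. by rewrite /w2 => lt_j; do ?case: ifP => ?; lia. Qed.

Lemma width5_w3_bound j : (j < h.*2)%N -> h%:Z <= w3 j <= (3 * h).-1.
Proof. by rewrite /w3 => lt_j; do ?case: ifP => ?; lia. Qed.

Lemma scheme5_even : exists Y, cyclic_scheme h.*2 5 Y.
Proof.
have h2_gt0 : (0 < h.*2)%N by lia.
(* These constants sum to 0 and place the five diagonals in adjacent intervals; the middle one, w2 -
   2h, omits 0 because w2 avoids 2h. *)
pose k := nth 0 [:: (3 * h).+1%:Z; (4 * h)%:Z; - h.*2%:Z; -1; - (5 * h)%:Z].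
eexists; apply: (@cyclic_scheme5 h.*2 h2_gt0 u v f k
  (nth 0 [:: (3 * h).+1%:Z; h%:Z + 1; - h%:Z; - (3 * h)%:Z; - (5 * h)%:Z])
  (nth 0 [:: (5 * h)%:Z; (3 * h)%:Z; h%:Z; - h%:Z - 1; - (3 * h)%:Z - 1])).
- by rewrite !big_ord_recr big_ord0 /k /=; lia.
- move=> j t lt_j; have lt_j' : (next h.*2 j < h.*2)%N by case: eqP; lia.
  rewrite width5_w1E // width5_w2E // width5_w3E //.
  have := width5_u_bound lt_j; have := width5_v_bound lt_j'.
  have := width5_w1_bound lt_j; have := width5_w2_bound lt_j;
    have := width5_w3_bound lt_j.
  move: (u j) (v (next _ _)) (w1 j) (w2 j) (w3 j) => {lt_j'} x y z1 z2 z3 bd1 bd2 bd3 bd4 bd5.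
  case: t => [|[|[|[|[|//]]]]] _; rewrite /k /=; (apply/andP; split;
    first apply: sma_supportI); lia.
- by move=> [|[|[|[|[|t1]]]]] [|[|[|[|[|t2]]]]] //=; lia.
- exact: width5_u_inj.
- exact: width5_v_inj.
- by move=> j1 j2 lt1 lt2; rewrite !width5_w1E //; apply: width5_w1_inj.
- by move=> j1 j2 lt1 lt2; rewrite !width5_w2E //; apply: width5_w2_inj.
- by move=> j1 j2 lt1 lt2; rewrite !width5_w3E //; apply: width5_w3_inj.
Qed.

End Width5Even.

(** * Existence of signed magic arrays *)

Lemma exists_scheme (L c : nat) : odd c -> (3 <= c <= L)%N ->
  exists Y, cyclic_scheme L c Y.
Proof.
move=> odd_c /andP[c_ge3 le_cL]; have L_gt0 : (0 < L)%N by lia.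
have [c3 | c1] : (c = 3 + 4 * (c %/ 4) \/ c = 5 + 4 * (c %/ 4).-1 /\ 5 <= c)%N by lia.
  rewrite c3; apply: cyclic_scheme_mod4 => //.
  have [odd_L | even_L] := boolP (odd L).
    have -> : L = L./2.*2.+1 by lia.
    exact: scheme3_odd.
  have -> : L = L./2.*2 by lia.
  have [odd_h | even_h] := boolP (odd L./2).
    by apply: scheme3_4odd => //; lia.
  by apply: scheme3_4even => //; lia.
case: c1 => cE c_ge5; rewrite cE; apply: cyclic_scheme_mod4 => //.
have [odd_L | even_L] := boolP (odd L).
  have -> : L = L./2.*2.+1 by lia.
  exact: scheme5_odd.
have -> : L = L./2.*2 by lia.
by apply: scheme5_even; lia.
Qed.

Lemma is_SMA_trmx (m n s k : nat) (A : pf_array m n) : (m * s = n * k)%N ->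
  is_SMA s k A -> is_SMA k s A^T.
Proof.
move=> eq_N [ent rowf colf once rows cols]; split.
- by move=> i j x; rewrite mxE eq_N; apply: ent.
- by move=> i; rewrite -(colf i); apply: eq_card => j; rewrite !inE mxE.
- by move=> j; rewrite -(rowf j); apply: eq_card => i; rewrite !inE mxE.
- move=> x; rewrite eq_N => /once <-.
  have swap_inj : injective (fun p : 'I_n * 'I_m => (p.2, p.1)) by move=> [? ?] [? ?] [-> ->].
  rewrite -(card_imset _ swap_inj); apply: eq_card => -[i j]; rewrite !inE /=.
  apply/imsetP/idP => [[[j1 i1]] | Aij]; first by rewrite inE mxE /= => + [-> ->].
  by exists (j, i); rewrite // inE mxE.
- move=> i; rewrite -[RHS](cols i) /row_sum /col_sum; apply: eq_big => [j|j _].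
    by rewrite !inE mxE.
  by rewrite mxE.
- move=> j; rewrite -[RHS](rows j) /row_sum /col_sum; apply: eq_big => [i|i _].
    by rewrite !inE mxE.
  by rewrite mxE.
Qed.

(** L/m and L/n are coprime and (L/n) s = (L/m) k, so s and k are L/m and L/n times a common factor,
    which is gcd(s, k). *)
Lemma SMA_parameters (m n s k : nat) : (0 < m)%N -> (0 < n)%N -> (m * s = n * k)%N ->
  let L := lcmn m n in
  [/\ s = L %/ m * gcdn s k, k = L %/ n * gcdn s k,
      m * s = gcdn s k * L, m = L %/ n * gcdn m n & n = L %/ m * gcdn m n]%N.
Proof.
move=> m_gt0 n_gt0 eq_N L; have d_gt0 : (0 < gcdn m n)%N by rewrite gcdn_gt0 m_gt0.
have Lm : (L %/ m * m = L)%N by rewrite divnK ?dvdn_lcml.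
have Ln : (L %/ n * n = L)%N by rewrite divnK ?dvdn_lcmr.
have Ld : (L * gcdn m n = m * n)%N by rewrite muln_lcm_gcd.
have mE : m = (L %/ n * gcdn m n)%N.
  by apply/eqP; rewrite -(eqn_pmul2r n_gt0) mulnAC Ln Ld.
have nE : n = (L %/ m * gcdn m n)%N.
  by apply/eqP; rewrite -(eqn_pmul2r m_gt0) mulnAC Lm Ld mulnC.
have co : coprime (L %/ m) (L %/ n).
  by rewrite /coprime -(eqn_pmul2r d_gt0) mul1n muln_gcdl -mE -nE gcdnC.
have eq_sk : (L %/ n * s = L %/ m * k)%N.
  apply/eqP; rewrite -(eqn_pmul2r d_gt0); apply/eqP.
  by rewrite mulnAC -mE eq_N {1}nE mulnAC.
have /dvdnP[x sE] : (L %/ m %| s)%N by rewrite -(Gauss_dvdr _ co) eq_sk dvdn_mulr.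
have L_gt0 : (0 < L)%N by rewrite lcmn_gt0 m_gt0.
have Lm_gt0 : (0 < L %/ m)%N by rewrite divn_gt0 // dvdn_leq ?dvdn_lcml.
have kE : (k = L %/ n * x)%N.
  by apply/eqP; rewrite -(eqn_pmul2l Lm_gt0) -eq_sk sE mulnA mulnC.
have gE : gcdn s k = x by rewrite sE kE mulnC -muln_gcdl (eqP co) mul1n.
split; rewrite ?gE //; first by rewrite sE mulnC.
by rewrite sE mulnCA [(m * _)%N]mulnC Lm.
Qed.

Lemma exists_SMA_even (m n s k c : nat) : (2 < s)%N -> (2 < k)%N ->
    (0 < m)%N -> (0 < n)%N -> (m * s = n * k)%N ->
    gcdn s k = c.*2 -> (c.*2 <= gcdn m n)%N ->
  exists A : pf_array m n, is_SMA s k A.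
Proof.
move=> s_ge3 k_ge3 m_gt0 n_gt0 eq_N gE le_cd.
have [] := SMA_parameters m_gt0 n_gt0 eq_N;
  rewrite gE -!doubleMr => sE kE msE mE nE.
have nkE : (n * k = c.*2 * lcmn m n)%N by rewrite -eq_N.
(* The two products tested are s/2 and k/2, which transposition exchanges. If both are odd, so are
   L/m, L/n and c. *)
have [oddW | evenW] := boolP (odd (lcmn m n %/ m * c));
  last exact: (@exists_SMA_even_width m n c).
have [oddV | evenV] := boolP (odd (lcmn m n %/ n * c)); last first.
  have := @exists_SMA_even_width n m c k s n_gt0 m_gt0; rewrite gcdnC lcmnC.
  move=> /(_ le_cd nkE msE evenV)[A A_SMA].
  by exists A^T; apply: is_SMA_trmx A_SMA.
have [odd_m | even_m] := boolP (odd m).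
  by apply: (@exists_SMA_odd_rows m n c) => //; lia.
have [m_mod0 | m_mod2] : (m %% 4 = 0 \/ m %% 4 = 2)%N by lia.
  by move: oddW oddV; rewrite !oddM => /andP[? ?] /andP[? ?];
    apply: (@exists_SMA_rows_mod4_0 m n c) => //; rewrite ?oddM; try (apply/andP;
      split); rewrite // ?/dvdn; lia.
have odd_c : odd c by move: oddW; rewrite oddM => /andP[].
have [lt_cd | ge_cd] := ltnP c.*2 (gcdn m n).
  by apply: (@exists_SMA_rows_mod4_2 m n c) => //; lia.
(* Now the array is full, and its sides n = s and m = k are twice odd numbers. *)
have dE : gcdn m n = c.*2 by apply/eqP; rewrite eqn_leq ge_cd.
have eq_sn : s = n by rewrite [LHS]sE [RHS]nE dE -doubleMr.
have eq_km : k = m by rewrite [LHS]kE [RHS]mE dE -doubleMr.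
by rewrite eq_sn eq_km; apply: exists_SMA_full; lia.
Qed.

Local Close Scope ring_scope.

Theorem theorem1p9 (m n s k : nat)
  (hs : 3 <= s <= n) (hk : 3 <= k <= m) (hmn : m * s = n * k)
  (hgcd : 2 <= gcdn s k) :
  exists A : pf_array m n, is_SMA s k A.
Proof.
have [s_ge3 le_sn] := andP hs; have [k_ge3 le_km] := andP hk.
have m_gt0 : 0 < m by lia.
have n_gt0 : 0 < n by lia.
have d_gt0 : 0 < gcdn m n by rewrite gcdn_gt0 m_gt0.
have [sE kE msE mE nE] := SMA_parameters m_gt0 n_gt0 hmn.
(* Divide s <= n by L/m. *)
have le_cd : gcdn s k <= gcdn m n.
  move: le_sn; rewrite {1}sE {2}nE leq_pmul2l // divn_gt0 // dvdn_leq ?dvdn_lcml //.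
  by rewrite lcmn_gt0 m_gt0.
have [odd_c | even_c] := boolP (odd (gcdn s k)); last first.
  apply: (@exists_SMA_even m n s k (gcdn s k)./2) => //; rewrite even_halfK //.
have [|Y schemeY] := @exists_scheme (lcmn m n) (gcdn s k) odd_c.
  have : gcdn m n <= lcmn m n.
    by rewrite (leq_trans (dvdn_leq m_gt0 (dvdn_gcdl m n))) // dvdn_leq ?dvdn_lcml // lcmn_gt0 m_gt0.
  by move: odd_c; case: (gcdn s k) hgcd le_cd => [|[|[|c]]] //; lia.
by apply: (cyclic_scheme_SMA m_gt0 n_gt0 le_cd msE _ schemeY); rewrite -hmn.
Qed.
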